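(* Let $(A_r)_{r\ge 0}$ be a sequence of diagram algebras over an integral domain $R$ with field of fractions $\mathbb{F}$ (see context). Let $r\ge 0$ and $\lambda\in\widehat A_r$. For every $\mathsf t\in \mathrm{Std}_r(\lambda)$ there exist coefficients $r_{\mathsf s}, r'_{\mathsf s}\in\mathbb F$ such that in $\Delta_r^{\mathbb F}(\lambda)$ $$m^\lambda_{\mathsf t} = f^\lambda_{\mathsf t}+\sum_{\mathsf s\in \mathrm{Std}_r(\lambda),\ \mathsf s\triangleright\mathsf t} r_{\mathsf s} f^\lambda_{\mathsf s},\qquad f^\lambda_{\mathsf t} = m^\lambda_{\mathsf t}+\sum_{\mathsf s\in \mathrm{Std}_r(\lambda),\ \mathsf s\triangleright\mathsf t} r'_{\mathsf s} m^\lambda_{\mathsf s}.$$ In particular, $\{f^\lambda_{\mathsf t} : \mathsf t\in\mathrm{Std}_r(\lambda)\}$ is a basis of $\Delta_r^{\mathbb F}(\lambda)$. Here $\triangleright$ is the dominance order on paths, $m^\lambda_{\mathsf t}$ is the Murphy basis and $f^\lambda_{\mathsf t}=m^\lambda_{\mathsf t}F_{\mathsf t}$ are the seminormal vectors.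
   Context: **Cellular algebras.** A cellular algebra over $R$ is a unital $R$-algebra $A$ with an algebra involution $*$ ($R$-linear anti-automorphism, $(x^* )^*=x$), a finite poset $(\widehat A,\trianglerighteq)$, a finite index set $T(\lambda)$ for each $\lambda\in\widehat A$, and an $R$-basis $\{c^\lambda_{st}:\lambda\in\widehat A,\ s,t\in T(\lambda)\}$ such that, with $A^{\triangleright\lambda}$ (resp. $A^{\trianglerighteq\lambda}$) the span of the $c^\mu_{st}$ with $\mu\triangleright\lambda$ (resp. $\mu\trianglerighteq\lambda$): (a) for $t\in T(\lambda)$, $a\in A$ there are $r(a;t,v)\in R$ with $c^\lambda_{st}a\equiv\sum_v r(a;t,v)c^\lambda_{sv}$ mod $A^{\triangleright\lambda}$ for all $s$; (b) $(c^\lambda_{st})^*\equiv c^\lambda_{ts}$ mod $A^{\triangleright\lambda}$. The cell module $\Delta(\lambda)$ is the right $A$-module, free over $R$ on $\{c^\lambda_t\}$, with $c^\lambda_t a=\sum_v r(a;t,v)c^\lambda_v$. There is an $A$-$A$-bimodule isomorphism $\alpha_\lambda:A^{\trianglerighteq\lambda}/A^{\triangleright\lambda}\to\Delta(\lambda)^*\otimes_R\Delta(\lambda)$, $c^\lambda_{st}+A^{\triangleright\lambda}\mapsto (c^\lambda_s)^*\otimes c^\lambda_t$, where $M^*$ is the left module obtained from a right module $M$ via $*$. $A$ is cyclic cellular if every cell module is cyclic. A cell filtration of a right module is a finite filtration $0=M_0\subseteq\dots\subseteq M_p$ with $M_i/M_{i-1}\cong\Delta(\lambda^{(i)})$; it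 is order preserving if $\lambda^{(i)}\triangleright\lambda^{(i+1)}$ for all $i$. **Sequence of diagram algebras.** $(A_r)_{r\ge0}$ is an increasing sequence of cellular algebras over $R$, with unital inclusions and compatible involutions; $\widehat A_r$ is the poset of $A_r$, $\Delta_r(\lambda)$ its cell modules, $A_r^{\mathbb F}=A_r\otimes_R\mathbb F$, $\Delta_r^{\mathbb F}(\lambda)=\Delta_r(\lambda)\otimes_R\mathbb F$. For each $\lambda\in\widehat A_r$ a generator $\delta_r(\lambda)$ of $\Delta_r(\lambda)$ and an element $m_\lambda\in A_r^{\trianglerighteq\lambda}$ with $\alpha_\lambda(m_\lambda+A_r^{\triangleright\lambda})=\delta_r(\lambda)^*\otimes\delta_r(\lambda)$ are fixed; $\Delta_r(\lambda)$ is identified with $(m_\lambda A_r+A_r^{\triangleright\lambda})/A_r^{\triangleright\lambda}$ via $\delta_r(\lambda)a\leftrightarrow m_\lambda a+A_r^{\triangleright\lambda}$. Axioms: (D1) $A_0=R$ ($\widehat A_0=\{\varnothing\}$, $\Delta_0(\varnothing)=R$, $m_\varnothing=1$); (D2) each $A_r$ is cyclic cellular; (D3) $m_\lambda=m_\lambda^*$; (D4) each $A_r^{\mathbb F}$ is split semisimple; (D5) (restriction coherence) for each $\mu\in\widehat A_{r+1}$ the restriction of $\Delta_{r+1}(\mu)$ to $A_r$ has an order preserving cell filtration; (D6) below. **Branching diagram, branching factors.** $\widehat A$ is the graded directed graph with vertex set $\widehat A_r$ at level $r$ and an edge $\lambda\to\mu$ ($\lambda\in\widehat A_{r-1}$,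 $\mu\in\widehat A_r$) iff $\Delta_{r-1}(\lambda)$ is a subquotient in the order preserving cell filtration of the restriction of $\Delta_r(\mu)$ to $A_{r-1}$. Fixing such a filtration $(M_j)$ with isomorphisms $M_j/M_{j-1}\cong\Delta_{r-1}(\lambda_j)$, the branching factor $d_{\lambda_j\to\mu}\in A_r$ is a chosen element with $\delta_r(\mu)d_{\lambda_j\to\mu}\in M_j$ whose class in $M_j/M_{j-1}$ corresponds to $\delta_{r-1}(\lambda_j)$. (D6): there are elements $u_{\mu\to\lambda}\in A_{r+1}$ for each edge $\mu\to\lambda$ ($\mu\in\widehat A_r,\lambda\in\widehat A_{r+1}$) with $m_\lambda d_{\mu\to\lambda}=(u_{\mu\to\lambda})^*m_\mu$. **Paths, Murphy basis.** $\mathrm{Std}_r(\nu)$ is the set of directed paths $\mathsf t=(\varnothing=\mathsf t(0)\to\mathsf t(1)\to\dots\to\mathsf t(r)=\nu)$, and $\mathrm{Std}_r=\bigcup_\nu\mathrm{Std}_r(\nu)$. For such $\mathsf t$, $d_{\mathsf t}=d_{\mathsf t(r-1)\to\mathsf t(r)}\cdots d_{\mathsf t(0)\to\mathsf t(1)}$. The Murphy basis of $\Delta_r(\nu)$ is $m^\nu_{\mathsf t}=m_\nu d_{\mathsf t}+A_r^{\triangleright\nu}$, $\mathsf t\in\mathrm{Std}_r(\nu)$; it is known to be an $R$-basis. **Dominance order on paths.** $\mathsf s\trianglerighteq\mathsf t$ iff $\mathsf s(j)\trianglerighteq\mathsf t(j)$ for all levels $j$; $\mathsf s\triangleright\mathsf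 t$ means $\mathsf s\trianglerighteq\mathsf t$ and $\mathsf s\ne\mathsf t$. **Gelfand–Zeitlin idempotents, seminormal vectors.** For $\lambda\in\widehat A_s$ let $z_s^\lambda$ be the minimal central idempotent of $A_s^{\mathbb F}$ corresponding to the simple module $\Delta_s^{\mathbb F}(\lambda)$. For $\mathsf t\in\mathrm{Std}_r$, $F_{\mathsf t}=\prod_{s=1}^r z_s^{\mathsf t(s)}$. For $\mathsf t\in\mathrm{Std}_r(\lambda)$, $f^\lambda_{\mathsf t}=m^\lambda_{\mathsf t}F_{\mathsf t}\in\Delta_r^{\mathbb F}(\lambda)$. *)

(* Defs.v *)
From HB Require Import structures.
From mathcomp Require Import all_boot all_order all_algebra.

Set Implicit Arguments.
Unset Strict Implicit.
Unset Printing Implicit Defensive.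

Import Order.TTheory GRing.Theory.
Local Open Scope ring_scope.

(* * Extension of scalars to the field of fractions *)

Record based_algebra (R : idomainType) := BasedAlgebra {
  ba_alg :> algType R;
  ba_idx : finType;
  ba_vec : ba_idx -> ba_alg;
  ba_basis : forall a : ba_alg,
    exists! k : {ffun ba_idx -> R}, a = \sum_i k i *: ba_vec i
}.

(* A (x)_R Frac(R), for A free over R on the basis b_i: the Frac(R)-space on
   the b_i, with the structure constants of A.  [ext_in a] is a (x) 1. *)
Definition scalar_ext (R : idomainType) (B : based_algebra R) : Type :=
  {ffun ba_idx B -> {fraction R}^o}.

Section ScalarExtension.
Variables (R : idomainType) (B : based_algebra R).
Local Notation F := {fraction R}.
Local Notation I := (ba_idx B).
Local Notation b := (@ba_vec R B).

Fact ba_basis_ex (a : B) :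
  exists k : {ffun I -> R}, a == \sum_i k i *: b i.
Proof. by have [k [/eqP ak _]] := ba_basis a; exists k. Qed.

Definition ba_coord (a : B) : {ffun I -> R} := xchoose (ba_basis_ex a).

Lemma ba_coordE a : a = \sum_i ba_coord a i *: b i.
Proof. exact/eqP/(xchooseP (ba_basis_ex a)). Qed.

Lemma ba_coord_uniq a (k : {ffun I -> R}) :
  a = \sum_i k i *: b i -> ba_coord a = k.
Proof.
by have [k' [_ uk]] := ba_basis a => ak; rewrite -(uk _ ak) (uk _ (ba_coordE a)).
Qed.

HB.instance Definition _ :=
  Vector.copy (scalar_ext B) {ffun I -> F^o}.

Definition ext_in (a : B) : scalar_ext B := [ffun i => tofrac (ba_coord a i)].

Definition ext_mul (x y : scalar_ext B) : scalar_ext B :=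
  \sum_i \sum_j (x i * y j : F) *: ext_in (b i * b j).

Lemma ba_coordD a1 a2 i : ba_coord (a1 + a2) i = ba_coord a1 i + ba_coord a2 i.
Proof.
rewrite (@ba_coord_uniq _ [ffun i => ba_coord a1 i + ba_coord a2 i]) ?ffunE //.
rewrite {1}[a1]ba_coordE {1}[a2]ba_coordE -big_split /=.
by apply: eq_bigr => j _; rewrite ffunE scalerDl.
Qed.

Lemma ba_coordZ k a i : ba_coord (k *: a) i = k * ba_coord a i.
Proof.
rewrite (@ba_coord_uniq _ [ffun i => k * ba_coord a i]) ?ffunE //.
rewrite {1}[a]ba_coordE scaler_sumr.
by apply: eq_bigr => j _; rewrite ffunE scalerA.
Qed.

Lemma ba_coord_vec i j : ba_coord (b i) j = (i == j)%:R.
Proof.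
rewrite (@ba_coord_uniq _ [ffun j => (i == j)%:R]) ?ffunE //.
rewrite (bigD1 i) //= ffunE eqxx scale1r big1 ?addr0 // => k ki.
by rewrite ffunE eq_sym (negPf ki) scale0r.
Qed.

Lemma ext_inD : {morph ext_in : a1 a2 / a1 + a2}.
Proof. by move=> a1 a2; apply/ffunP=> i; rewrite !ffunE ba_coordD rmorphD. Qed.

Lemma ext_inZ k a : ext_in (k *: a) = tofrac k *: ext_in a.
Proof. by apply/ffunP=> i; rewrite !ffunE ba_coordZ rmorphM. Qed.

Lemma ext_in0 : ext_in 0 = 0.
Proof. by apply: (addIr (ext_in 0)); rewrite -ext_inD !add0r. Qed.

Lemma ext_in_sum (J : finType) (G : J -> B) :
  ext_in (\sum_j G j) = \sum_j ext_in (G j).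
Proof. exact: (big_morph ext_in ext_inD ext_in0). Qed.

Lemma ext_in_inj : injective ext_in.
Proof.
move=> a1 a2 /ffunP e; rewrite [a1]ba_coordE [a2]ba_coordE.
apply: eq_bigr => i _; congr (_ *: _).
by have /eqP := e i; rewrite !ffunE tofrac_eq => /eqP.
Qed.

Lemma ext_vecE (x : scalar_ext B) : x = \sum_i (x i : F) *: ext_in (b i).
Proof.
apply/ffunP=> j; rewrite sum_ffunE (bigD1 j) //= big1 => [|i ij].
  by rewrite !ffunE ba_coord_vec eqxx addr0 tofrac1 [_ *: _]mulr1.
by rewrite !ffunE ba_coord_vec (negPf ij) tofrac0 [_ *: _]mulr0.
Qed.

Lemma ext_mulDl : left_distributive ext_mul +%R.
Proof.
move=> x y z; rewrite -big_split /=; apply: eq_bigr => i _.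
rewrite -big_split /=; apply: eq_bigr => j _.
by rewrite !ffunE mulrDl scalerDl.
Qed.

Lemma ext_mulDr : right_distributive ext_mul +%R.
Proof.
move=> x y z; rewrite -big_split /=; apply: eq_bigr => i _.
rewrite -big_split /=; apply: eq_bigr => j _.
by rewrite !ffunE mulrDr scalerDl.
Qed.

Lemma ext_mulZl (k : F) x y : k *: ext_mul x y = ext_mul (k *: x) y.
Proof.
rewrite scaler_sumr; apply: eq_bigr => i _.
rewrite scaler_sumr; apply: eq_bigr => j _.
by rewrite !ffunE scalerA [k *: _]/(k * _) mulrA.
Qed.

Lemma ext_mulZr (k : F) x y : k *: ext_mul x y = ext_mul x (k *: y).
Proof.
rewrite scaler_sumr; apply: eq_bigr => i _.
rewrite scaler_sumr; apply: eq_bigr => j _.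
by rewrite !ffunE scalerA [k *: _]/(k * _) mulrCA.
Qed.

Lemma ext_mul_in a1 a2 : ext_mul (ext_in a1) (ext_in a2) = ext_in (a1 * a2).
Proof.
rewrite {2}[a1]ba_coordE mulr_suml ext_in_sum; apply: eq_bigr => i _.
rewrite {2}[a2]ba_coordE mulr_sumr ext_in_sum; apply: eq_bigr => j _.
by rewrite !ffunE -tofracM -ext_inZ -scalerAl -scalerAr scalerA.
Qed.

Lemma ext_mul0l x : ext_mul 0 x = 0.
Proof. by apply: (addIr (ext_mul 0 x)); rewrite -ext_mulDl !add0r. Qed.

Lemma ext_mul0r x : ext_mul x 0 = 0.
Proof. by apply: (addIr (ext_mul x 0)); rewrite -ext_mulDr !add0r. Qed.

Lemma scalar_ext_ind (P : scalar_ext B -> Prop) :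
    P 0 -> (forall x y, P x -> P y -> P (x + y)) ->
    (forall (k : F) a, P (k *: ext_in a)) -> forall x, P x.
Proof.
by move=> P0 PD PZ x; rewrite [x]ext_vecE; elim/big_ind: _ => // i _; exact: PZ.
Qed.

Lemma ext_mulA : associative ext_mul.
Proof.
move=> x y z; elim/scalar_ext_ind: x => [|x1 x2 IH1 IH2|k a].
- by rewrite !ext_mul0l.
- by rewrite !ext_mulDl IH1 IH2.
rewrite -!ext_mulZl; congr (k *: _).
elim/scalar_ext_ind: y => [|y1 y2 IH1 IH2|l b'].
- by rewrite !(ext_mul0l, ext_mul0r).
- by rewrite ext_mulDl !ext_mulDr ext_mulDl IH1 IH2.
rewrite -ext_mulZl -!ext_mulZr -ext_mulZl; congr (l *: _).
elim/scalar_ext_ind: z => [|z1 z2 IH1 IH2|m c].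
- by rewrite !ext_mul0r.
- by rewrite !ext_mulDr IH1 IH2.
by rewrite -!ext_mulZr !ext_mul_in mulrA.
Qed.

Lemma ext_mul1l : left_id (ext_in 1) ext_mul.
Proof.
elim/scalar_ext_ind=> [|x1 x2 IH1 IH2|k a]; first exact: ext_mul0r.
  by rewrite ext_mulDr IH1 IH2.
by rewrite -ext_mulZr ext_mul_in mul1r.
Qed.

Lemma ext_mul1r : right_id (ext_in 1) ext_mul.
Proof.
elim/scalar_ext_ind=> [|x1 x2 IH1 IH2|k a]; first exact: ext_mul0l.
  by rewrite ext_mulDl IH1 IH2.
by rewrite -ext_mulZl ext_mul_in mulr1.
Qed.

Lemma ext_1_neq0 : ext_in 1 != 0.
Proof. by rewrite -ext_in0 (inj_eq ext_in_inj) oner_eq0. Qed.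

HB.instance Definition _ := GRing.Zmodule_isNzRing.Build (scalar_ext B)
  ext_mulA ext_mul1l ext_mul1r ext_mulDl ext_mulDr ext_1_neq0.
HB.instance Definition _ :=
  GRing.Lmodule_isLalgebra.Build F (scalar_ext B) ext_mulZl.
HB.instance Definition _ :=
  GRing.Lalgebra_isAlgebra.Build F (scalar_ext B) ext_mulZr.

End ScalarExtension.

(* f (x) Frac(R), for f an R-linear map. *)
Definition ext_map (R : idomainType) (B C : based_algebra R) (f : B -> C)
    (x : scalar_ext B) : scalar_ext C :=
  \sum_i (x i : {fraction R}) *: ext_in (f (ba_vec i)).

(* * Cellular algebras *)

(* The R-span of the c^mu_st with mu satisfying P. *)
Definition cell_span (R : idomainType) (A : algType R) (L : finType)
    (T : L -> finType) (c : forall la, T la -> T la -> A) (P : pred L)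
    (a : A) : Prop :=
  exists k : {ffun {la : L & (T la * T la)%type} -> R},
    a = \sum_(i | P (tag i)) k i *: c (tag i) (tagged i).1 (tagged i).2.

(* [ca_coef a t v] is the coefficient r(a; t, v); it is determined by
   [ca_mul] and [ca_basis].  The relation "la dominates mu" is (mu <= la)%O. *)
Record cellular_algebra (R : idomainType) := CellularAlgebra {
  ca_alg :> algType R;
  ca_inv : {linear ca_alg -> ca_alg};
  ca_invM : forall a a', ca_inv (a * a') = ca_inv a' * ca_inv a;
  ca_invK : involutive ca_inv;
  ca_disp : Order.disp_t;
  ca_shape : finPOrderType ca_disp;
  ca_tab : ca_shape -> finType;
  ca_bas : forall la, ca_tab la -> ca_tab la -> ca_alg;
  ca_basis : forall a : ca_alg,
    exists! k : {ffun {la : ca_shape & (ca_tab la * ca_tab la)%type} -> R},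
      a = \sum_i k i *: ca_bas (tagged i).1 (tagged i).2;
  ca_coef : forall la, ca_alg -> ca_tab la -> ca_tab la -> R;
  ca_mul : forall la (t : ca_tab la) (a : ca_alg) (s : ca_tab la),
    cell_span ca_bas (fun mu => (la < mu)%O)
      (ca_bas s t * a - \sum_v ca_coef a t v *: ca_bas s v);
  ca_inv_bas : forall la (s t : ca_tab la),
    cell_span ca_bas (fun mu => (la < mu)%O)
      (ca_inv (ca_bas s t) - ca_bas t s)
}.

Definition cell_based (R : idomainType) (A : cellular_algebra R) :
    based_algebra R :=
  BasedAlgebra (@ca_basis R A).

Section Cellular.
Variables (R : idomainType) (A : cellular_algebra R).
Implicit Types la mu : ca_shape A.

Definition in_ideal_ge la (a : A) : Prop :=
  cell_span (@ca_bas R A) (fun mu => (la <= mu)%O) a.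
Definition in_ideal_gt la (a : A) : Prop :=
  cell_span (@ca_bas R A) (fun mu => (la < mu)%O) a.

(* The right cell module, free on the c_t, and its right A-action. *)
Definition cell_mod la := {ffun ca_tab la -> R^o}.
Definition cell_act la (x : cell_mod la) (a : A) : cell_mod la :=
  [ffun v => \sum_t x t * ca_coef a t v].

(* A representative in A of the preimage of x^* (x) y under alpha_la. *)
Definition cell_tensor la (x y : cell_mod la) : A :=
  \sum_s \sum_t (x s * y t : R) *: ca_bas s t.

Definition alg_frac := scalar_ext (cell_based A).
Definition cell_mod_frac la := {ffun ca_tab la -> {fraction R}^o}.
Definition cell_mod_in la (x : cell_mod la) : cell_mod_frac la :=
  [ffun t => tofrac (x t : R)].
Definition cell_act_frac la (x : cell_mod_frac la) (a : alg_frac) :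
    cell_mod_frac la :=
  [ffun v => \sum_i \sum_t
     x t * a i * tofrac (ca_coef (@ba_vec R (cell_based A) i) t v)].

HB.instance Definition _ := GRing.Algebra.on alg_frac.

End Cellular.

(* E is isomorphic to a finite product of matrix algebras over F. *)
Definition split_semisimple (F : fieldType) (E : algType F) : Prop :=
  exists (n : nat) (d : 'I_n -> nat)
         (phi : forall i, {lrmorphism E -> 'M[F]_((d i).+1)}),
    forall y : (forall i, 'M[F]_((d i).+1)), exists! x : E, forall i, phi i x = y i.

Definition central_idempotent (E : nzRingType) (e : E) : Prop :=
  e * e = e /\ forall x, e * x = x * e.

Definition minimal_central_idempotent (E : nzRingType) (z : E) : Prop :=
  [/\ central_idempotent z, z <> 0
    & forall e : E, central_idempotent e -> e * z = e -> e = 0 \/ e = z].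

(* A central idempotent acts on a simple module as 0 or as the identity; the
   minimal one corresponding to the simple module is the one not acting as 0. *)
Definition is_cell_idempotent (R : idomainType) (A : cellular_algebra R)
    (la : ca_shape A) (z : alg_frac A) : Prop :=
  minimal_central_idempotent z /\
  exists x : cell_mod_frac la, cell_act_frac x z <> 0.

(* * Cell filtrations of restricted cell modules *)

(* M_j is [cf_sub j] for 0 <= j <= p.  The isomorphism
   M_{j+1} / M_j ~ Delta(cf_shape j) is given by the surjection [cf_map j] from
   M_{j+1}, with kernel M_j; values of [cf_map j] off M_{j+1} are irrelevant. *)
Record cell_filtration (R : idomainType) (A B : cellular_algebra R)
    (f : A -> B) (mu : ca_shape B) := CellFiltration {
  cf_len : nat;
  cf_shape : 'I_cf_len -> ca_shape A;
  cf_sub : nat -> cell_mod mu -> Prop;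
  cf_map : forall j : 'I_cf_len, cell_mod mu -> cell_mod (cf_shape j);
  cf_sub_bot : forall x, cf_sub 0 x <-> x = 0;
  cf_sub_top : forall x, cf_sub cf_len x;
  cf_sub_incl : forall (j : 'I_cf_len) x, cf_sub j x -> cf_sub j.+1 x;
  cf_sub_zero : forall j, (j <= cf_len)%N -> cf_sub j 0;
  cf_sub_add : forall j x y, (j <= cf_len)%N ->
    cf_sub j x -> cf_sub j y -> cf_sub j (x + y);
  cf_sub_act : forall j x a, (j <= cf_len)%N ->
    cf_sub j x -> cf_sub j (cell_act x (f a));
  cf_map_add : forall (j : 'I_cf_len) x y, cf_sub j.+1 x -> cf_sub j.+1 y ->
    cf_map j (x + y) = cf_map j x + cf_map j y;
  cf_map_act : forall (j : 'I_cf_len) x a, cf_sub j.+1 x ->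
    cf_map j (cell_act x (f a)) = cell_act (cf_map j x) a;
  cf_map_surj : forall (j : 'I_cf_len) y,
    exists2 x, cf_sub j.+1 x & cf_map j x = y;
  cf_map_ker : forall (j : 'I_cf_len) x, cf_sub j.+1 x ->
    (cf_map j x = 0 <-> cf_sub j x)
}.

Definition order_preserving (R : idomainType) (A B : cellular_algebra R)
    (f : A -> B) (mu : ca_shape B) (M : cell_filtration f mu) : Prop :=
  forall i j : 'I_(cf_len M), j = i.+1 :> nat ->
    (cf_shape j < cf_shape i)%O.

Definition is_branch (R : idomainType) (A B : cellular_algebra R)
    (f : A -> B) (mu : ca_shape B) (M : cell_filtration f mu) : pred (ca_shape A) :=
  fun la => [exists j, cf_shape (c := M) j == la].

(* * Sequences of diagram algebras *)

(* [da_gen la] is delta_r(la) and [da_m la] is m_la.  For an edge la -> mu,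
   [da_d la mu] is the branching factor d_{la -> mu}; its values on non-edges
   are irrelevant. *)
Record diagram_algebras (R : idomainType) := DiagramAlgebras {
  da_alg :> nat -> cellular_algebra R;
  da_incl : forall r, {lrmorphism da_alg r -> da_alg r.+1};
  da_incl_inj : forall r, injective (da_incl r);
  da_incl_inv : forall r (a : da_alg r),
    da_incl r (ca_inv _ a) = ca_inv _ (da_incl r a);
  da_gen : forall r (la : ca_shape (da_alg r)), cell_mod la;
  da_m : forall r, ca_shape (da_alg r) -> da_alg r;
  da_m_ge : forall r (la : ca_shape (da_alg r)), in_ideal_ge la (da_m la);
  da_m_gen : forall r (la : ca_shape (da_alg r)),
    in_ideal_gt la (da_m la - cell_tensor (da_gen la) (da_gen la));
  da_alg0 : bijective (fun k : R => k%:A : da_alg 0);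
  da_shape0 : #|ca_shape (da_alg 0)| = 1%N;
  da_tab0 : forall la : ca_shape (da_alg 0), #|ca_tab la| = 1%N;
  da_m0 : forall la : ca_shape (da_alg 0), da_m la = 1;
  da_cyclic : forall r (la : ca_shape (da_alg r)) (x : cell_mod la),
    exists a, x = cell_act (da_gen la) a;
  da_m_inv : forall r (la : ca_shape (da_alg r)), ca_inv _ (da_m la) = da_m la;
  da_split : forall r, split_semisimple (alg_frac (da_alg r));
  da_filt : forall r (mu : ca_shape (da_alg r.+1)),
    cell_filtration (da_incl r) mu;
  da_filt_op : forall r (mu : ca_shape (da_alg r.+1)),
    order_preserving (da_filt mu);
  da_d : forall r, ca_shape (da_alg r) -> ca_shape (da_alg r.+1) -> da_alg r.+1;
  da_d_sub : forall r (mu : ca_shape (da_alg r.+1)) (j : 'I_(cf_len (da_filt mu))),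
    cf_sub (da_filt mu) j.+1 (cell_act (da_gen mu) (da_d (cf_shape j) mu));
  da_d_map : forall r (mu : ca_shape (da_alg r.+1)) (j : 'I_(cf_len (da_filt mu))),
    cf_map j (cell_act (da_gen mu) (da_d (cf_shape j) mu))
      = da_gen (cf_shape j);
  da_u : forall r (mu : ca_shape (da_alg r)) (la : ca_shape (da_alg r.+1)),
    is_branch (da_filt la) mu ->
    exists u : da_alg r.+1,
      da_m la * da_d mu la = ca_inv _ u * da_incl r (da_m mu)
}.

Section Paths.
Variables (R : idomainType) (A : diagram_algebras R).

(* A path to nu at level r+1 is an edge la -> nu with a path to la at level r;
   at level 0 there is only the trivial path. *)
Fixpoint Std (r : nat) : ca_shape (A r) -> finType :=
  match r return ca_shape (A r) -> finType with
  | 0 => fun _ => unit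
  | r'.+1 => fun nu =>
      {la : {la : ca_shape (A r') | is_branch (da_filt nu) la} & Std (val la)}
  end.

(* s dominates t: s(j) dominates t(j) at each level j <= r. *)
Fixpoint path_dom (r : nat) :
    forall mu nu : ca_shape (A r), Std mu -> Std nu -> bool :=
  match r return forall mu nu : ca_shape (A r), Std mu -> Std nu -> bool with
  | 0 => fun mu nu _ _ => (nu <= mu)%O
  | r'.+1 => fun mu nu s t =>
      (nu <= mu)%O && path_dom (tagged s) (tagged t)
  end.

Definition path_sdom (r : nat) (nu : ca_shape (A r)) (s t : Std nu) : bool :=
  path_dom s t && (s != t).

Fixpoint path_d (r : nat) : forall nu : ca_shape (A r), Std nu -> A r :=
  match r return forall nu : ca_shape (A r), Std nu -> A r with
  | 0 => fun _ _ => 1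
  | r'.+1 => fun nu t =>
      da_d (val (tag t)) nu * da_incl A r' (path_d (tagged t))
  end.

(* m_nu d_t + A^{> nu}, through delta(nu) a <-> m_nu a + A^{> nu}. *)
Definition murphy (r : nat) (nu : ca_shape (A r)) (t : Std nu) : cell_mod nu :=
  cell_act (da_gen nu) (path_d t).

Variable z : forall r, ca_shape (A r) -> alg_frac (A r).

Fixpoint path_F (r : nat) : forall nu : ca_shape (A r), Std nu -> alg_frac (A r) :=
  match r return forall nu : ca_shape (A r), Std nu -> alg_frac (A r) with
  | 0 => fun _ _ => 1
  | r'.+1 => fun nu t =>
      ext_map (B := cell_based (A r')) (C := cell_based (A r'.+1))
        (da_incl A r') (path_F (tagged t)) * z nu
  end.

Definition seminormal (r : nat) (nu : ca_shape (A r)) (t : Std nu) :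
    cell_mod_frac nu :=
  cell_act_frac (cell_mod_in (murphy t)) (path_F t).

End Paths.

(* Main.v *)
Require Import Defs.
From mathcomp Require Import all_boot all_order all_algebra.
From Stdlib Require Import Classical_Prop.
Import Order.TTheory GRing.Theory.
Local Open Scope ring_scope.

Set Implicit Arguments.
Unset Strict Implicit.
Unset Printing Implicit Defensive.

(** Write E_r for the algebra A_r over the field of fractions F and V(la) for
    the cell module over F.  The seminormal vectors are common eigenvectors of
    the orthogonal idempotents F_s: the vector f_t is fixed by F_t and killed
    by every other F_s.  They span V(la), so m_t = sum_s c_s f_s for some
    coefficients, and applying F_s gives c_s f_s = m_t F_s.  In particular
    c_t = 1 because f_t = m_t F_t is nonzero.  The triangularity is therefore
    the statement that m_t F_s = 0 unless s dominates t at every level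
    ([murphy_path_F]).

    This vanishing comes from the relations m_la d = u^* m_mu on the edges.
    Peeling off the edges of t from the top shows that m_la d_t is, for each
    level q, a left multiple of an element of the cell ideal of A_q of shape
    t(q) ([murphy_element_path_F] is the resulting induction).  Over F that
    ideal is generated by a central idempotent which acts as zero on the cell
    modules of all shapes nu not dominating t(q), so the minimal idempotent
    z^nu of such a shape annihilates the ideal ([cell_idempotent_ideal]).

    That the f_t are nonzero and span is proved by induction on the level.
    Since z^la acts on V(la) as the identity ([cell_idempotent_act]), the
    vector f_t is m_t F_t', where t' is t without its last step.  It thus lies
    in a term M_j of the filtration of V(la) and is sent to f_t' in the section
    M_j / M_{j-1} ([seminormal_quot]).  The filtration is only given over R;
    its sections are carried to F by clearing denominators ([frac_quot]).

    The facts about the z^la rest on the semisimplicity of E_r: every two-sided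
    ideal has a central idempotent as unit ([ideal_unit]).  Applied to the cell
    ideal of la, this makes the bilinear form of the cell nondegenerate, and
    the cell module irreducible ([cell_mod_irreducible]).  The dominance
    triangular expansion is finally inverted by [unitriangular_inv]. *)

(** * Denominators *)

Section Fractions.
Variable R : idomainType.
Local Notation F := {fraction R}.

Lemma fraction_denom (x : F) :
  exists2 d : R, d != 0 & exists n, tofrac d * x = tofrac n.
Proof.
elim/quotW: x => y; have y2 := denom_ratioP y.
exists (frac y).2 => //; exists (frac y).1; unlock tofrac.
rewrite -[LHS]FracField.pi_mul; apply/eqmodP; rewrite /= FracField.equivfE.
by rewrite /FracField.mulf !numden_Ratio ?mulf_neq0 ?oner_neq0 // !mul1r mulr1 mulrC.
Qed.

Lemma common_denom (I : finType) (x : I -> F) :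
  exists2 d : R, d != 0 &
    exists n : I -> R, forall i, tofrac d * x i = tofrac (n i).
Proof.
have [d d0 dx] := fin_all_exists2 (fun i => fraction_denom (x i)).
have [n dxn] := fin_all_exists dx.
exists (\prod_i d i); first exact/prodf_neq0.
exists (fun i => (\prod_(j | j != i) d j) * n i) => i.
by rewrite (bigD1 i) //= !tofracM -dxn mulrA [_ * tofrac (d i)]mulrC.
Qed.

End Fractions.

(** * Ideals of split semisimple algebras *)

Section SplitSemisimple.
Variables (F : fieldType) (E : algType F) (J : E -> Prop).
Hypotheses (J0 : J 0) (JD : forall x y, J x -> J y -> J (x + y)).
Hypotheses (JMl : forall a x, J x -> J (a * x)).
Hypotheses (JMr : forall a x, J x -> J (x * a)).

Lemma ideal_sum (I : Type) (s : seq I) (G : I -> E) :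
  (forall i, J (G i)) -> J (\sum_(i <- s) G i).
Proof. by move=> JG; elim/big_ind: _. Qed.

(** The algebra is a product of matrix blocks.  Wherever the ideal has a nonzero
    image, sandwiching an element between matrix units produces the identity of
    that block inside the ideal; the unit is the sum of these identities.  Whether
    the image in a block vanishes is decided classically. *)
Lemma ideal_unit :
  split_semisimple E ->
  exists e, [/\ J e, central_idempotent e & forall x, J x -> x * e = x].
Proof.
case=> n [d [phi bij]].
have lift y : exists x, forall i, phi i x = y i.
  by have [x [xy _]] := bij y; exists x.
have inj x y : (forall i, phi i x = phi i y) -> x = y.
  move=> xy; have [w [_ uw]] := bij (fun i => phi i y).
  by rewrite -(uw x) // (uw y).
have lift1 i (M : 'M[F]_((d i).+1)) :
    exists x, phi i x = M /\ forall j, i != j -> phi j x = 0.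
  have [x xM] := lift (dfwith (fun j => 0) M); exists x; split.
    by rewrite xM dfwith_in.
  by move=> j ij; rewrite xM dfwith_out.
have local i : exists e, [/\ J e, forall j, i != j -> phi j e = 0,
    phi i e = 0 \/ phi i e = 1 & forall x, J x -> phi i x * phi i e = phi i x].
  have [[x Jx /eqP x0]|J_0] := classic (exists2 x, J x & phi i x <> 0); last first.
    exists 0; split=> //; first by move=> j _; rewrite raddf0.
      by left; rewrite raddf0.
    move=> x Jx; rewrite raddf0 mulr0; have [//|x0] := eqVneq (phi i x) 0.
    by case: J_0; exists x => //; apply/eqP.
  have /matrix0Pn [a [b xab]] := x0.
  have [y yP] := fin_all_exists
    (fun k => lift1 i ((phi i x a b)^-1 *: delta_mx k a)).
  have [w wP] := fin_all_exists (fun k => lift1 i (delta_mx b k)).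
  (* In the i-th block, the sum over k of E_ka X E_bk / X_ab is the identity. *)
  have e1 : phi i (\sum_k y k * x * w k) = 1.
    rewrite raddf_sum /=; transitivity (\sum_k (delta_mx k k : 'M[F]_((d i).+1))).
      apply: eq_bigr => k _; rewrite !rmorphM /= (yP k).1 (wP k).1.
      rewrite -!mulmxE -!scalemxAl.
      have -> : delta_mx k a *m phi i x *m delta_mx b k = phi i x a b *: delta_mx k k.
        apply/matrixP=> p q; rewrite !mxE (bigD1 b) //= big1 => [|l lb].
          rewrite !mxE (bigD1 a) //= big1 => [|l la]; last first.
            by rewrite !mxE (negPf la) andbF mul0r.
          rewrite !mxE !eqxx andbT /= !addr0.
          by case: (p == k); case: (q == k); rewrite ?(mul0r, mul1r, mulr0, mulr1).
        by rewrite [delta_mx b k l q]mxE (negPf lb) mulr0.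
      by rewrite scalerA mulVf // scale1r.
    apply/matrixP=> p q; rewrite summxE !mxE (bigD1 p) //= big1 => [|l lp].
      by rewrite !mxE eqxx addr0 eq_sym.
    by rewrite !mxE eq_sym (negPf lp).
  exists (\sum_k y k * x * w k); split; last by move=> u _; rewrite e1 mulr1.
  - by apply: ideal_sum => k; apply/JMr/JMl.
  - move=> j ij; rewrite raddf_sum big1 //= => k _.
    by rewrite !rmorphM /= (yP k).2 // !mul0r.
  - by right.
have [e eP] := fin_all_exists local.
have phie i : phi i (\sum_j e j) = phi i (e i).
  rewrite raddf_sum (bigD1 i) //= big1 ?addr0 // => j ji.
  by have [_ e0 _ _] := eP j; rewrite e0.
exists (\sum_j e j); split.
- by apply: ideal_sum => i; have [] := eP i.
- split=> [|x]; apply: inj => i; rewrite !rmorphM /= phie;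
    have [_ _ [] -> _] := eP i; by rewrite ?(mul0r, mulr0, mul1r, mulr1).
- by move=> x Jx; apply: inj => i; rewrite rmorphM /= phie; have [_ _ _ ->] := eP i.
Qed.

End SplitSemisimple.

(** * Cell ideals and cell modules over the field of fractions *)

Section Cell.
Variables (R : idomainType) (A : cellular_algebra R).
Local Notation F := {fraction R}.
Local Notation E := (alg_frac A).
Local Notation I := (ba_idx (cell_based A)).
Local Notation coord := (@ba_coord R (cell_based A)).
Local Notation ein := (@ext_in R (cell_based A)).
Implicit Types (la mu : ca_shape A) (P Q : pred (ca_shape A)).

Definition cell_index la (s t : ca_tab la) : I :=
  Tagged (fun la => (ca_tab la * ca_tab la)%type) (s, t).

(** Membership in the span of the cells in P, read off from the coordinates, so
    that it is stable under sums without choosing expansions. *)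
Definition supported P (a : A) : Prop := forall i : I, ~~ P (tag i) -> coord a i = 0.

Lemma coordD (a b : A) i : coord (a + b) i = coord a i + coord b i.
Proof. exact: (@ba_coordD R (cell_based A)). Qed.

Lemma coordZ k (a : A) i : coord (k *: a) i = k * coord a i.
Proof. exact: (@ba_coordZ R (cell_based A)). Qed.

Lemma coord0 i : coord (0 : A) i = 0.
Proof. by rewrite -(scale0r 0) coordZ mul0r. Qed.

Lemma coord_sum (J : finType) (p : pred J) (G : J -> A) i :
  coord (\sum_(j | p j) G j) i = \sum_(j | p j) coord (G j) i.
Proof.
by apply: (big_morph (fun a => coord a i)) => [a b|]; rewrite ?coord0 ?coordD.
Qed.

Lemma coord_basis la (s t : ca_tab la) i :
  coord (ca_bas s t) i = (cell_index s t == i)%:R.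
Proof. exact: (@ba_coord_vec R (cell_based A) (cell_index s t)). Qed.

Lemma cell_index_eq la (s t s' t' : ca_tab la) :
  (cell_index s t == cell_index s' t') = (s == s') && (t == t').
Proof.
by rewrite /cell_index -tag_eqE /tag_eq /= eqxx tagged_asE xpair_eqE.
Qed.

Lemma supported_expand P a : supported P a ->
  a = \sum_(i | P (tag i)) coord a i *: ca_bas (tagged i).1 (tagged i).2.
Proof.
move=> sa; rewrite {1}[a](@ba_coordE R (cell_based A)) [RHS]big_mkcond /=.
by apply: eq_bigr => i _; case: ifPn => // /sa ->; rewrite scale0r.
Qed.

Lemma supportedP P a : cell_span (@ca_bas R A) P a <-> supported P a.
Proof.
split=> [[k ->] i Pi|sa].
  rewrite coord_sum big1 // => -[la [s t]] /= Pj.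
  rewrite coordZ coord_basis; case: eqP => [e|]; last by rewrite mulr0.
  by case/negP: Pi; rewrite -e.
by exists (coord a); apply: supported_expand.
Qed.

Lemma supportedD P a b : supported P a -> supported P b -> supported P (a + b).
Proof. by move=> sa sb i Pi; rewrite coordD (sa i Pi) (sb i Pi) addr0. Qed.

Lemma supportedZ P k a : supported P a -> supported P (k *: a).
Proof. by move=> sa i Pi; rewrite coordZ (sa i Pi) mulr0. Qed.

Lemma supported_sum P (J : finType) (p : pred J) (G : J -> A) :
  (forall j, p j -> supported P (G j)) -> supported P (\sum_(j | p j) G j).
Proof.
move=> sG; elim/big_ind: _ => //; last exact: supportedD.
by move=> i _; rewrite coord0.
Qed.

Lemma supported_basis P la (s t : ca_tab la) : P la -> supported P (ca_bas s t).
Proof.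
by move=> Pla i; rewrite coord_basis; case: eqP => [<- /=|//]; rewrite Pla.
Qed.

Lemma sub_supported P Q a : (forall mu, P mu -> Q mu) -> supported P a -> supported Q a.
Proof. by move=> PQ sa i Qi; apply: sa; apply: contra Qi; exact: PQ. Qed.

(** The spans of the cells in upper sets are the two-sided ideals that the cell
    structure provides. *)
Definition upper P := forall la mu, P la -> (la <= mu)%O -> P mu.

Lemma upper_ge la : upper (fun mu => la <= mu)%O.
Proof. by move=> ka mu; apply: le_trans. Qed.

Lemma upper_gt la : upper (fun mu => la < mu)%O.
Proof. by move=> ka mu; apply: lt_le_trans. Qed.

Lemma upper_gt_sub P la a : upper P -> P la ->
  supported (fun mu => la < mu)%O a -> supported P a.
Proof.
by move=> uP Pla; apply: sub_supported => mu /ltW; apply: uP.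
Qed.

Lemma coord_gt la (s t : ca_tab la) a :
  supported (fun mu => la < mu)%O a -> coord a (cell_index s t) = 0.
Proof. by apply; rewrite /= ltxx. Qed.

Lemma basis_mulr la (s t : ca_tab la) a :
  exists2 y, supported (fun mu => la < mu)%O y &
    ca_bas s t * a = \sum_v ca_coef a t v *: ca_bas s v + y.
Proof.
have /supportedP sy := ca_mul t a s.
by exists (ca_bas s t * a - \sum_v ca_coef a t v *: ca_bas s v); rewrite // addrC subrK.
Qed.

Lemma supported_mulr P a b : upper P -> supported P a -> supported P (a * b).
Proof.
move=> uP /supported_expand ->; rewrite mulr_suml.
apply: supported_sum => -[la [s t]] /= Pla.
rewrite -scalerAl; apply: supportedZ; have [y sy ->] := basis_mulr s t b.
apply: supportedD; last exact: (upper_gt_sub uP Pla sy).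
by apply: supported_sum => v _; apply: supportedZ; apply: supported_basis.
Qed.

Lemma basis_inv la (s t : ca_tab la) :
  exists2 y, supported (fun mu => la < mu)%O y &
    ca_inv A (ca_bas s t) = ca_bas t s + y.
Proof.
have /supportedP sy := ca_inv_bas s t.
by exists (ca_inv A (ca_bas s t) - ca_bas t s); rewrite // addrC subrK.
Qed.

Lemma supported_inv P a : upper P -> supported P a -> supported P (ca_inv A a).
Proof.
move=> uP /supported_expand ->; rewrite raddf_sum.
apply: supported_sum => -[la [s t]] /= Pla.
rewrite linearZ /=; apply: supportedZ; have [y sy ->] := basis_inv s t.
by apply: supportedD; [apply: supported_basis | exact: (upper_gt_sub uP Pla sy)].
Qed.

(** The multiplication rule of the cells only speaks of right multiplication; the
    involution, which fixes these ideals, transfers it to the left. *)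
Lemma supported_mull P a b : upper P -> supported P b -> supported P (a * b).
Proof.
move=> uP sb; rewrite -[a * b](ca_invK) ca_invM.
by apply: supported_inv => //; apply: supported_mulr => //; apply: supported_inv.
Qed.

Lemma basis_mull la (u v : ca_tab la) a :
  exists2 y, supported (fun mu => la < mu)%O y &
    a * ca_bas u v = \sum_w ca_coef (ca_inv A a) u w *: ca_bas w v + y.
Proof.
have ugt := @upper_gt la.
have [y1 sy1 e1] := basis_inv u v.
have [y2 sy2 e2] := basis_mulr v u (ca_inv A a).
have [y3 e3] := fin_all_exists2 (fun w => basis_inv v w).
move=> y3E; exists (\sum_w ca_coef (ca_inv A a) u w *: y3 w + ca_inv A (y2 + y1 * ca_inv A a)).
  apply: supportedD; first by apply: supported_sum => w _; apply/supportedZ/e3.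
  by apply: supported_inv => //; apply: supportedD => //; apply: supported_mulr.
rewrite -[a * _]ca_invK ca_invM e1 mulrDl e2 -addrA raddfD /= raddf_sum addrA.
congr (_ + _); rewrite -big_split /=; apply: eq_bigr => w _.
by rewrite linearZ /= y3E scalerDr.
Qed.

Lemma coord_mulr la (s t s' v : ca_tab la) a :
  coord (ca_bas s t * a) (cell_index s' v) = (s == s')%:R * ca_coef a t v.
Proof.
have [y sy ->] := basis_mulr s t a.
rewrite coordD (coord_gt _ _ sy) addr0 coord_sum (bigD1 v) //= big1 => [|w wv].
  by rewrite coordZ coord_basis cell_index_eq eqxx andbT addr0 mulrC.
by rewrite coordZ coord_basis cell_index_eq (negPf wv) andbF mulr0.
Qed.

Lemma coord_mull la (u v w v' : ca_tab la) a :
  coord (a * ca_bas u v) (cell_index w v') = (v == v')%:R * ca_coef (ca_inv A a) u w.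
Proof.
have [y sy ->] := basis_mull u v a.
rewrite coordD (coord_gt _ _ sy) addr0 coord_sum (bigD1 w) //= big1 => [|x xw].
  by rewrite coordZ coord_basis cell_index_eq eqxx addr0 mulrC.
by rewrite coordZ coord_basis cell_index_eq (negPf xw) mulr0.
Qed.

(** The bilinear form of the cell: modulo higher cells, c_st c_uv is the value
    of this form at (t, u) times c_sv.  It is read off from the left
    factor, whose left action the involution turns into a right action, the only
    one that [ca_coef] records. *)
Definition cell_form la (t u : ca_tab la) : R := ca_coef (ca_inv A (ca_bas t t)) u t.

(** Comparing the right rule and the left rule on the product c_tt c_uv: the
    first keeps the row t, the second keeps the column v. *)
Lemma coef_basis la (t u v w : ca_tab la) :
  ca_coef (ca_bas u v) t w = (v == w)%:R * cell_form t u.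
Proof. by rewrite -coord_mull coord_mulr eqxx mul1r. Qed.

Definition frac_supported P (x : E) : Prop := forall i : I, ~~ P (tag i) -> x i = 0.

Lemma frac_supported_in P a : supported P a -> frac_supported P (ein a).
Proof. by move=> sa i Pi; rewrite ffunE (sa i Pi) tofrac0. Qed.

Lemma frac_mulE (x y : E) (k : I) :
  (x * y) k = \sum_i \sum_j x i * y j * tofrac (coord (ba_vec i * ba_vec j) k).
Proof.
rewrite [x * y]/(ext_mul x y) sum_ffunE; apply: eq_bigr => i _.
by rewrite sum_ffunE; apply: eq_bigr => j _; rewrite !ffunE.
Qed.

Lemma frac_addE (x y : E) i : (x + y) i = x i + y i.
Proof. by rewrite ffunE. Qed.

Lemma ein_mul (a b : A) : (ein a : E) * (ein b : E) = ein (a * b).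
Proof. exact: (@ext_mul_in R (cell_based A)). Qed.

Section Ideal.
Variables (P : pred (ca_shape A)) (uP : upper P).

Lemma frac_supported0 : frac_supported P 0.
Proof. by move=> i _; rewrite ffunE. Qed.

Lemma frac_supportedD (x y : E) :
  frac_supported P x -> frac_supported P y -> frac_supported P (x + y).
Proof. by move=> sx sy i Pi; rewrite ffunE (sx i Pi) (sy i Pi) addr0. Qed.

Lemma frac_supported_mull (a x : E) : frac_supported P x -> frac_supported P (a * x).
Proof.
move=> sx k Pk; rewrite frac_mulE big1 // => i _; rewrite big1 // => j _.
have [Pj|/sx ->] := boolP (P (tag j)); last by rewrite mulr0 mul0r.
by rewrite (@supported_mull P) ?tofrac0 ?mulr0 //; apply: supported_basis.
Qed.

Lemma frac_supported_mulr (a x : E) : frac_supported P x -> frac_supported P (x * a).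
Proof.
move=> sx k Pk; rewrite frac_mulE big1 // => i _; rewrite big1 // => j _.
have [Pi|/sx ->] := boolP (P (tag i)); last by rewrite !mul0r.
by rewrite (@supported_mulr P) ?tofrac0 ?mulr0 //; apply: supported_basis.
Qed.

Lemma frac_supportedZ k (x : E) : frac_supported P x -> frac_supported P (k *: x).
Proof. by move=> sx i Pi; rewrite ffunE (sx i Pi) [k *: _]mulr0. Qed.

End Ideal.

Section Module.
Variable la : ca_shape A.
Local Notation V := (cell_mod_frac la).

Lemma frac_basis_mulE (s t : ca_tab la) (a : E) (k : I) :
  (ein (ca_bas s t) * a) k = \sum_j a j * tofrac (coord (ca_bas s t * ba_vec j) k).
Proof.
rewrite frac_mulE (bigD1 (cell_index s t)) //= [X in _ + X]big1 => [|i ist].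
  rewrite addr0; apply: eq_bigr => j _.
  by rewrite ffunE coord_basis eqxx tofrac1 mul1r.
by rewrite big1 // => j _; rewrite ffunE coord_basis eq_sym (negPf ist) tofrac0 !mul0r.
Qed.

(** Row s of the cell is a copy of the cell module inside the algebra, stable on
    the right modulo the higher cells.  The module axioms are inherited from the
    associativity of the algebra through these copies. *)
Definition cell_row (s : ca_tab la) (x : V) : E :=
  \sum_t (x t : F) *: (ein (ca_bas s t) : E).

Lemma cell_row_mul_coord (s s' : ca_tab la) (x : V) (a : E) (v : ca_tab la) :
  (cell_row s x * a) (cell_index s' v) = (s == s')%:R * cell_act_frac x a v.
Proof.
rewrite ffunE mulr_suml sum_ffunE exchange_big mulr_sumr /=; apply: eq_bigr => t _.
rewrite -scalerAl ffunE frac_basis_mulE [_ *: _]mulr_sumr mulr_sumr.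
apply: eq_bigr => j _; rewrite coord_mulr tofracM rmorph_nat.
by case: (s == s'); rewrite ?mul1r ?mulrA // !(mul0r, mulr0).
Qed.

Lemma cell_act_row (s : ca_tab la) (x : V) (a : E) (v : ca_tab la) :
  cell_act_frac x a v = (cell_row s x * a) (cell_index s v).
Proof. by rewrite cell_row_mul_coord eqxx mul1r. Qed.

Lemma cell_row_coord (s s' : ca_tab la) (x : V) (v : ca_tab la) :
  cell_row s x (cell_index s' v) = (s == s')%:R * (x v : F).
Proof.
rewrite sum_ffunE (bigD1 v) //= big1 => [|t tv].
  rewrite !ffunE coord_basis cell_index_eq eqxx andbT addr0 rmorph_nat.
  by rewrite [_ *: _]mulrC.
by rewrite !ffunE coord_basis cell_index_eq (negPf tv) andbF tofrac0 [_ *: _]mulr0.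
Qed.

Lemma cell_row_supported s x : frac_supported (fun mu => la <= mu)%O (cell_row s x).
Proof.
rewrite /cell_row; elim/big_ind: _ => [||t _].
- exact: frac_supported0.
- exact: frac_supportedD.
- by apply/frac_supportedZ/frac_supported_in/supported_basis/lexx.
Qed.

Lemma cell_row_mul s (x : V) (a : E) :
  exists2 y, frac_supported (fun mu => la < mu)%O y &
    cell_row s x * a = cell_row s (cell_act_frac x a) + y.
Proof.
exists (cell_row s x * a - cell_row s (cell_act_frac x a)); last by rewrite addrC subrK.
move=> i nlt; rewrite !ffunE.
have [lai|nlai] := boolP (la <= tag i)%O; last first.
  rewrite (frac_supported_mulr (@upper_ge la) _ (cell_row_supported s x)) //.
  by rewrite (@cell_row_supported s _ i nlai) subr0.
case: i lai nlt => ka [s' v] /= lai nlt.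
have ka_la : ka = la.
  by apply/esym/eqP; move: lai; rewrite le_eqVlt (negPf nlt) orbF.
rewrite {ka lai nlt}ka_la in s' v *.
by rewrite cell_row_mul_coord cell_row_coord subrr.
Qed.

(** Two elements congruent modulo the higher cells have the same row
    coordinates, also after a further right multiplication. *)
Lemma cell_actM (x : V) (a b : E) :
  cell_act_frac x (a * b) = cell_act_frac (cell_act_frac x a) b.
Proof.
apply/ffunP=> v; have [y sy e] := cell_row_mul v x a.
have y0 : (y * b) (cell_index v v) = 0.
  by apply: (frac_supported_mulr (@upper_gt la) b sy); rewrite /= ltxx.
have key : cell_row v x * (a * b) = cell_row v (cell_act_frac x a) * b + y * b.
  by apply: etrans (mulrA _ _ _) _; apply: etrans (congr1 ( *%R^~ b) e) _; apply: mulrDl.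
apply: etrans (cell_act_row v x _ v) _; apply: etrans _ (esym (cell_act_row v _ b v)).
apply: etrans (congr1 (fun z : E => z (cell_index v v)) key) _.
by apply: etrans (frac_addE _ _ _) _; apply: etrans (congr1 (+%R _) y0) (addr0 _).
Qed.

Lemma cell_act1 (x : V) : cell_act_frac x 1 = x.
Proof. by apply/ffunP=> v; rewrite (cell_act_row v) mulr1 cell_row_coord eqxx mul1r. Qed.

Lemma cell_actDl (a : E) : {morph (fun x : V => cell_act_frac x a) : x y / x + y}.
Proof.
move=> x y; apply/ffunP=> v; rewrite !ffunE -big_split; apply: eq_bigr => i _.
by rewrite -big_split; apply: eq_bigr => t _; rewrite !ffunE !mulrDl.
Qed.

Lemma cell_actZl k (x : V) (a : E) : cell_act_frac (k *: x) a = k *: cell_act_frac x a.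
Proof.
apply/ffunP=> v; rewrite !ffunE [RHS]mulr_sumr; apply: eq_bigr => i _.
by rewrite mulr_sumr; apply: eq_bigr => t _; rewrite !ffunE !mulrA.
Qed.

Lemma cell_actDr (x : V) : {morph (fun a : E => cell_act_frac x a) : a b / a + b}.
Proof.
move=> a b; apply/ffunP=> v; apply: etrans (cell_act_row v x _ v) _.
apply: etrans (congr1 (fun z : E => z _) (mulrDr _ _ _)) _.
apply: etrans (frac_addE _ _ _) _; apply: etrans _ (esym (ffunE _ _)).
by congr (_ + _); apply: esym (cell_act_row v x _ v).
Qed.

Lemma cell_actZr k (x : V) (a : E) : cell_act_frac x (k *: a) = k *: cell_act_frac x a.
Proof.
apply/ffunP=> v; apply: etrans (cell_act_row v x _ v) _.
apply: etrans (congr1 (fun z : E => z _) (esym (scalerAr _ _ _))) _.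
apply: etrans (ffunE _ _) _; apply: etrans _ (esym (ffunE _ _)).
by congr (_ *: _); apply: esym (cell_act_row v x _ v).
Qed.

Lemma cell_act0l (a : E) : cell_act_frac (0 : V) a = 0.
Proof. by rewrite -[X in cell_act_frac X](scale0r 0) cell_actZl scale0r. Qed.

Lemma cell_act0r (x : V) : cell_act_frac x (0 : E) = 0.
Proof. by rewrite -[X in cell_act_frac _ X](scale0r 0) cell_actZr scale0r. Qed.

Lemma cell_act_sumr (J : finType) (G : J -> E) (x : V) :
  cell_act_frac x (\sum_j G j) = \sum_j cell_act_frac x (G j).
Proof. exact: (big_morph _ (@cell_actDr x) (cell_act0r x)). Qed.

Lemma cell_act_suml (J : finType) (p : pred J) (G : J -> V) (a : E) :
  cell_act_frac (\sum_(j | p j) G j) a = \sum_(j | p j) cell_act_frac (G j) a.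
Proof. exact: (big_morph _ (@cell_actDl a) (cell_act0l a)). Qed.

Lemma cell_act_in (x : cell_mod la) (a : A) :
  cell_mod_in (cell_act x a) = cell_act_frac (cell_mod_in x) (ein a).
Proof.
apply/ffunP=> v; rewrite (cell_act_row v) /cell_row mulr_suml sum_ffunE !ffunE.
rewrite rmorph_sum; apply: eq_bigr => t _ /=.
apply: esym; have key : (tofrac (x t : R) *: (ein (ca_bas v t) : E)) * (ein a : E)
    = tofrac (x t : R) *: (ein (ca_bas v t * a) : E).
  by apply: etrans (esym (scalerAl _ _ _)) _; congr (_ *: _); apply: ein_mul.
have -> : cell_mod_in x t = tofrac (x t : R) by rewrite ffunE.
apply: etrans (congr1 (fun z : E => z (cell_index v v)) key) _.
by rewrite !ffunE coord_mulr eqxx mul1r tofracM.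
Qed.

(** Inside the algebra, the row of x times a lies in the ideal of a, which has no
    coordinate in the cell la. *)
Lemma cell_act_supported P (x : V) (a : E) :
  upper P -> ~~ P la -> frac_supported P a -> cell_act_frac x a = 0.
Proof.
move=> uP Pla sa; apply/ffunP=> v; rewrite (cell_act_row v) ffunE.
exact: (frac_supported_mull uP).
Qed.

End Module.
End Cell.

(** * The central idempotents attached to the cells *)

Section CentralIdempotents.
Variable E : nzRingType.

Lemma central_idempotentM (e f : E) :
  central_idempotent e -> central_idempotent f -> central_idempotent (e * f).
Proof.
move=> [ee ce] [ff cf]; split=> [|x]; last by rewrite -mulrA cf mulrA ce mulrA.
by rewrite mulrA -[e * f * e]mulrA cf mulrA ee -mulrA ff.
Qed.

Lemma central_idempotent_absorb (z a : E) :
  central_idempotent z -> z * (a * z) = z * a.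
Proof. by move=> [zz cz]; rewrite -cz mulrA zz. Qed.

Lemma minimal_central_idempotent_dich (e z : E) :
  minimal_central_idempotent z -> central_idempotent e -> e * z = 0 \/ e * z = z.
Proof.
move=> [cz _ minz] ce; apply: minz; first exact: central_idempotentM.
by rewrite -mulrA cz.1.
Qed.

(** The product is below both idempotents, hence zero or equal to each. *)
Lemma minimal_central_idempotent_orth (z z' : E) :
  minimal_central_idempotent z -> minimal_central_idempotent z' -> z <> z' -> z * z' = 0.
Proof.
move=> mz mz' zz'; have [cz _ _] := mz; have [cz' _ _] := mz'.
have [//|zE] := minimal_central_idempotent_dich mz' cz.
have [|zE'] := minimal_central_idempotent_dich mz cz'; first by rewrite cz'.2.
by case: zz'; rewrite -zE' -[RHS]zE cz'.2.
Qed.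

End CentralIdempotents.

Section CellIdempotents.
Variables (R : idomainType) (A : cellular_algebra R).
Hypothesis ss : split_semisimple (alg_frac A).
Local Notation F := {fraction R}.
Local Notation E := (alg_frac A).
Local Notation ein := (@ext_in R (cell_based A)).
Implicit Types (la mu nu : ca_shape A) (P : pred (ca_shape A)).

Lemma cell_ideal_unit P : upper P ->
  exists e : E, [/\ frac_supported P e, central_idempotent e
    & forall x, frac_supported P x -> x * e = x].
Proof.
move=> uP; apply: (@ideal_unit _ _ (@frac_supported R A P)) ss.
- exact: frac_supported0.
- exact: frac_supportedD.
- by move=> a x; apply: frac_supported_mull.
- by move=> a x; apply: frac_supported_mulr.
Qed.

(** The rows that copy the cell module lie in the cell ideal. *)
Lemma cell_act_unit la (e : E) (x : cell_mod_frac la) :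
  (forall y, frac_supported (fun mu => la <= mu)%O y -> y * e = y) ->
  cell_act_frac x e = x.
Proof.
move=> eP; apply/ffunP=> v; apply: etrans (cell_act_row v x e v) _.
have -> := eP _ (@cell_row_supported R A la v x).
by rewrite cell_row_coord eqxx mul1r.
Qed.

Lemma cell_act_basis la (x : cell_mod_frac la) (u v : ca_tab la) :
  cell_act_frac x (ein (ca_bas u v)) =
    (\sum_t (x t : F) * tofrac (cell_form t u)) *: [ffun w => (v == w)%:R].
Proof.
apply/ffunP=> w; rewrite !ffunE (bigD1 (cell_index u v)) //= [X in _ + X]big1.
  rewrite addr0 [RHS]mulr_suml; apply: eq_bigr => t _.
  by rewrite ffunE coord_basis eqxx coef_basis tofracM !rmorph_nat mulr1 mulrA mulrAC.
move=> i iuv; rewrite big1 // => t _.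
by rewrite ffunE coord_basis eq_sym (negPf iuv) mulr0 mul0r.
Qed.

(** If the form pairs x with some c_u nontrivially, then x c_uv is a nonzero
    multiple of c_v for every v.  Otherwise x is killed by the whole cell ideal,
    in particular by the unit of that ideal, which fixes x. *)
Lemma cell_mod_irreducible la (x w : cell_mod_frac la) :
  x != 0 -> exists a : E, cell_act_frac x a = w.
Proof.
move=> x0; pose g u : F := \sum_t (x t : F) * tofrac (cell_form t u).
have [u gu|g0] := pickP (fun u => g u != 0).
  exists (\sum_v ((w v : F) / g u) *: (ein (ca_bas u v) : E)).
  rewrite cell_act_sumr; apply/ffunP=> v; rewrite sum_ffunE (bigD1 v) //= big1.
    rewrite addr0 cell_actZr cell_act_basis -/(g u) !ffunE eqxx.
    by rewrite [g u *: _]mulr1 [_ *: _]mulfVK.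
  move=> t tv; rewrite cell_actZr cell_act_basis !ffunE (negPf tv).
  by rewrite [X in _ *: X]mulr0 [_ *: _]mulr0.
have [e [se _ eP]] := cell_ideal_unit (@upper_ge R A la).
case/negP: x0; rewrite -(cell_act_unit x eP) (@ext_vecE R (cell_based A) e).
rewrite cell_act_sumr big1 // => -[mu [s t]] _; rewrite cell_actZr.
have [mula|nmula] := eqVneq mu la.
  rewrite {mu}mula in s t *; rewrite cell_act_basis.
  by have /negbFE/eqP := g0 s; rewrite /g => ->; rewrite scale0r scaler0.
have [lemu|nlemu] := boolP (la <= mu)%O; last by rewrite se // scale0r.
rewrite (@cell_act_supported R A la (fun mu => la < mu)%O) ?scaler0 //.
- exact: upper_gt.
- by rewrite ltxx.
- by apply/frac_supported_in/supported_basis; rewrite lt_neqAle eq_sym nmula.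
Qed.

(** A central idempotent acts on an irreducible module as zero or the identity. *)
Lemma cell_idempotent_act la (z : E) (x : cell_mod_frac la) :
  is_cell_idempotent la z -> cell_act_frac x z = x.
Proof.
move=> [[cz _ _] [y /eqP yz]]; have [a <-] := cell_mod_irreducible x yz.
apply: etrans (esym (cell_actM _ a z)) _; apply: etrans (esym (cell_actM y z _)) _.
by apply: etrans (cell_actM y z a); rewrite central_idempotent_absorb.
Qed.

(** The unit e of the cell ideal of mu acts as zero on the cell module of nu,
    whereas z does not; so e z differs from z, and by minimality e z = 0. *)
Lemma cell_idempotent_ideal mu nu (z y : E) :
  is_cell_idempotent nu z -> ~~ (mu <= nu)%O ->
  frac_supported (fun ka => mu <= ka)%O y -> y * z = 0.
Proof.
move=> [mz [x xz]] munu sy; have [e [se ce eP]] := cell_ideal_unit (@upper_ge R A mu).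
suff ez : e * z = 0 by rewrite -(eP y sy) -mulrA ez mulr0.
have [//|ez] := minimal_central_idempotent_dich mz ce.
case: xz; rewrite -ez cell_actM (cell_act_supported _ (@upper_ge R A mu) munu se).
exact: cell_act0l.
Qed.

(** Otherwise z annihilates the unit of the cell ideal of mu, and with it the
    cell module of mu. *)
Lemma cell_idempotent_le mu nu (z : E) :
  is_cell_idempotent mu z -> is_cell_idempotent nu z -> (mu <= nu)%O.
Proof.
move=> [mz [x xz]] hnu; apply: contraT => munu.
have [e [se ce eP]] := cell_ideal_unit (@upper_ge R A mu).
case: xz; rewrite -(cell_act_unit x eP) -cell_actM.
by rewrite (cell_idempotent_ideal hnu munu se) cell_act0r.
Qed.

Lemma cell_idempotent_orth mu nu (z z' : E) :
  is_cell_idempotent mu z -> is_cell_idempotent nu z' -> mu != nu -> z * z' = 0.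
Proof.
move=> hz hz' munu; apply: minimal_central_idempotent_orth; [exact: hz.1 | exact: hz'.1 |].
move=> zz'; case/negP: munu; rewrite -zz' in hz'.
by rewrite eq_le !(cell_idempotent_le _ hz, cell_idempotent_le _ hz').
Qed.

End CellIdempotents.

(** * Extension of scalars for inclusions and cell filtrations *)

Section ScalarExtensionMaps.
Variables (R : idomainType) (A B : cellular_algebra R) (f : {lrmorphism A -> B}).
Local Notation F := {fraction R}.
Local Notation einA := (@ext_in R (cell_based A)).
Local Notation einB := (@ext_in R (cell_based B)).

Definition frac_map (x : alg_frac A) : alg_frac B :=
  ext_map (B := cell_based A) (C := cell_based B) f x.

Lemma frac_mapD : {morph frac_map : x y / x + y}.
Proof.
move=> x y; rewrite /frac_map /ext_map -big_split /=; apply: eq_bigr => i _.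
by rewrite ffunE scalerDl.
Qed.

Lemma frac_mapZ k : {morph frac_map : x / k *: x}.
Proof.
move=> x; rewrite /frac_map /ext_map scaler_sumr; apply: eq_bigr => i _.
by rewrite ffunE scalerA.
Qed.

Lemma frac_map0 : frac_map 0 = 0.
Proof. by rewrite -(scale0r 0) frac_mapZ scale0r. Qed.

Lemma frac_map_in a : frac_map (einA a) = einB (f a).
Proof.
rewrite {2}[a](@ba_coordE R (cell_based A)) raddf_sum /=.
rewrite (@ext_in_sum R (cell_based B)); apply: eq_bigr => i _.
by rewrite ffunE linearZ /= (@ext_inZ R (cell_based B)).
Qed.

Lemma frac_mapM : {morph frac_map : x y / x * y}.
Proof.
move=> x y; elim/(@scalar_ext_ind R (cell_based A)): x => [|x1 x2 IH1 IH2|k a].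
- by rewrite frac_map0 !mul0r frac_map0.
- apply: etrans (congr1 frac_map (mulrDl _ _ _)) _; apply: etrans (frac_mapD _ _) _.
  apply: etrans (congr2 +%R IH1 IH2) _; apply: etrans (esym (mulrDl _ _ _)) _.
  by congr (_ * _); apply: esym; apply: frac_mapD.
elim/(@scalar_ext_ind R (cell_based A)): y => [|y1 y2 IH1 IH2|l b].
- by rewrite frac_map0 !mulr0 frac_map0.
- apply: etrans (congr1 frac_map (mulrDr _ _ _)) _; apply: etrans (frac_mapD _ _) _.
  apply: etrans (congr2 +%R IH1 IH2) _; apply: etrans (esym (mulrDr _ _ _)) _.
  by congr (_ * _); apply: esym; apply: frac_mapD.
apply: etrans (congr1 frac_map (esym (scalerAl k _ _))) _.
apply: etrans (frac_mapZ _ _) _; apply: etrans _ (congr1 ( *%R^~ _) (esym (frac_mapZ _ _))).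
apply: etrans _ (scalerAl k _ _); congr (_ *: _).
apply: etrans (congr1 frac_map (esym (scalerAr l _ _))) _.
apply: etrans (frac_mapZ _ _) _; apply: etrans _ (congr1 ( *%R _) (esym (frac_mapZ _ _))).
apply: etrans _ (scalerAr l _ _); congr (_ *: _).
apply: etrans (congr1 frac_map (ein_mul a b)) _.
apply: etrans (frac_map_in _) _; apply: etrans (congr1 einB (rmorphM f a b)) _.
apply: etrans (esym (ein_mul (f a) (f b))) _.
by congr (_ * _); apply: esym; apply: frac_map_in.
Qed.

Lemma frac_denom (x : alg_frac A) :
  exists2 d : R, d != 0 & exists a, tofrac d *: x = einA a.
Proof.
have [d d0 [n dx]] := common_denom (x : {ffun _ -> F}).
exists d => //; exists (\sum_i n i *: (ba_vec i : A)); apply/ffunP=> i.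
rewrite !ffunE [LHS]dx; congr tofrac; rewrite coord_sum (bigD1 i) //= big1 => [|j ji].
  by rewrite coordZ (@ba_coord_vec R (cell_based A)) eqxx mulr1 addr0.
by rewrite coordZ (@ba_coord_vec R (cell_based A)) (negPf ji) mulr0.
Qed.

End ScalarExtensionMaps.

Section CellModule.
Variables (R : idomainType) (A : cellular_algebra R) (la : ca_shape A).
Implicit Types x y : cell_mod la.

Lemma cell_mod_in_inj : injective (@cell_mod_in R A la).
Proof.
move=> x y /ffunP xy; apply/ffunP=> t; have /eqP := xy t.
by rewrite !ffunE tofrac_eq => /eqP.
Qed.

Lemma cell_mod_inD : {morph @cell_mod_in R A la : x y / x + y}.
Proof. by move=> x y; apply/ffunP=> t; rewrite !ffunE rmorphD. Qed.

Lemma cell_mod_inZ k x : cell_mod_in (k *: x) = tofrac k *: cell_mod_in x.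
Proof. by apply/ffunP=> t; rewrite !ffunE rmorphM. Qed.

Lemma cell_mod_in0 : cell_mod_in (0 : cell_mod la) = 0.
Proof. by apply/ffunP=> t; rewrite !ffunE tofrac0. Qed.

Lemma cell_act_scalar x k : cell_act x (k%:A) = k *: x.
Proof.
apply: cell_mod_in_inj; rewrite cell_act_in cell_mod_inZ.
rewrite (@ext_inZ R (cell_based A)) cell_actZr; congr (_ *: _).
exact: cell_act1.
Qed.

Lemma cell_act_mul x (a b : A) : cell_act x (a * b) = cell_act (cell_act x a) b.
Proof.
apply: cell_mod_in_inj; rewrite !cell_act_in; apply: etrans (cell_actM _ _ _).
by congr cell_act_frac; apply: esym; apply: ein_mul.
Qed.

Lemma cell_mod_denom (v : cell_mod_frac la) :
  exists2 d : R, d != 0 & exists x, tofrac d *: v = cell_mod_in x.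
Proof.
have [d d0 [n dv]] := common_denom v.
by exists d => //; exists [ffun t => n t]; apply/ffunP=> t; rewrite !ffunE [LHS]dv.
Qed.

End CellModule.

Section FractionFiltration.
Variables (R : idomainType) (A B : cellular_algebra R) (f : {lrmorphism A -> B}).
Variables (mu : ca_shape B) (M : cell_filtration f mu).
Local Notation F := {fraction R}.
Implicit Type j : 'I_(cf_len M).

Definition frac_sub k (v : cell_mod_frac mu) : Prop :=
  exists d x, [/\ d != 0, cf_sub M k x & tofrac d *: v = cell_mod_in x].

(** The graph, over the field of fractions, of the surjection onto the j-th
    section.  A relation avoids choosing denominators; it is a linear map
    by [frac_quotD], [frac_quotZ] and [frac_quot0]. *)
Definition frac_quot j (v : cell_mod_frac mu)
    (w : cell_mod_frac (cf_shape (c := M) j)) : Prop :=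
  exists d x, [/\ d != 0, cf_sub M j.+1 x, tofrac d *: v = cell_mod_in x
    & tofrac d *: w = cell_mod_in (cf_map (c := M) j x)].

Lemma cf_sub_scale k x (c : R) :
  (k <= cf_len M)%N -> cf_sub M k x -> cf_sub M k (c *: x).
Proof.
move=> lek Mx; rewrite -(cell_act_scalar x c).
by have := @cf_sub_act _ _ _ _ _ M k x c%:A lek Mx; rewrite linearZ rmorph1.
Qed.

Lemma cf_map_scale j x (c : R) :
  cf_sub M j.+1 x -> cf_map (c := M) j (c *: x) = c *: cf_map (c := M) j x.
Proof.
move=> Mx; rewrite -!cell_act_scalar -(cf_map_act _ Mx).
by congr (cf_map _ (cell_act _ _)); rewrite linearZ rmorph1.
Qed.

Lemma frac_quotD j v w v' w' :
  frac_quot (j := j) v w -> frac_quot v' w' -> frac_quot (v + v') (w + w').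
Proof.
move=> [d [x [d0 Mx dv dw]]] [d' [x' [d'0 Mx' dv' dw']]].
have [sx sx'] : cf_sub M j.+1 (d' *: x) /\ cf_sub M j.+1 (d *: x').
  by split; apply: cf_sub_scale.
exists (d * d'), (d' *: x + d *: x'); split; first by rewrite mulf_neq0.
- exact: cf_sub_add.
- by rewrite cell_mod_inD !cell_mod_inZ -dv -dv' !scalerA -!tofracM [d' * d]mulrC scalerDr.
- rewrite cf_map_add // !cf_map_scale // cell_mod_inD !cell_mod_inZ -dw -dw'.
  by rewrite !scalerA -!tofracM [d' * d]mulrC scalerDr.
Qed.

Lemma frac_quotZ j (k : F) v w : frac_quot (j := j) v w -> frac_quot (k *: v) (k *: w).
Proof.
move=> [d [x [d0 Mx dv dw]]]; have [e e0 [n ek]] := fraction_denom k.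
exists (e * d), (n *: x); split; first by rewrite mulf_neq0.
- exact: cf_sub_scale.
- by rewrite cell_mod_inZ -dv !scalerA tofracM mulrAC ek.
- by rewrite cf_map_scale // cell_mod_inZ -dw !scalerA tofracM mulrAC ek.
Qed.

Lemma frac_quot_act j v w (a : alg_frac A) : frac_quot (j := j) v w ->
  frac_quot (cell_act_frac v (frac_map f a)) (cell_act_frac w a).
Proof.
move=> [d [x [d0 Mx dv dw]]]; have [e e0 [b eb]] := frac_denom a.
exists (d * e), (cell_act x (f b)); split; first by rewrite mulf_neq0.
- exact: cf_sub_act.
- rewrite cell_act_in -dv cell_actZl -frac_map_in -eb frac_mapZ cell_actZr.
  by rewrite scalerA -tofracM.
- by rewrite cf_map_act // cell_act_in -dw cell_actZl -eb cell_actZr scalerA -tofracM.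
Qed.

Lemma frac_quot_total j v : frac_sub j.+1 v -> exists w, frac_quot (j := j) v w.
Proof.
move=> [d [x [d0 Mx dv]]]; exists ((tofrac d)^-1 *: cell_mod_in (cf_map (c := M) j x)).
by exists d, x; split=> //; rewrite scalerA mulfV ?tofrac_eq0 // scale1r.
Qed.

Lemma frac_quot_ker j v : frac_quot (j := j) v 0 -> frac_sub j v.
Proof.
move=> [d [x [d0 Mx dv dw]]]; exists d, x; split=> //.
by apply/(cf_map_ker Mx)/cell_mod_in_inj; rewrite -dw scaler0 cell_mod_in0.
Qed.

Lemma cf_map0 j : cf_map (c := M) j 0 = 0.
Proof.
have M0 : cf_sub M j.+1 0 by apply: cf_sub_zero.
by apply/(cf_map_ker M0)/cf_sub_zero/ltnW.
Qed.

Lemma frac_quot00 j : frac_quot (j := j) 0 0.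
Proof.
exists 1, 0; rewrite oner_neq0 !scaler0 cf_map0 !cell_mod_in0; split=> //.
exact: cf_sub_zero.
Qed.

Lemma frac_quot0 j w : frac_quot (j := j) 0 w -> w = 0.
Proof.
move=> [d [x [d0 Mx dv dw]]].
have x0 : x = 0 by apply: cell_mod_in_inj; rewrite -dv scaler0 cell_mod_in0.
have /eqP := dw; rewrite x0 cf_map0 cell_mod_in0 scaler_eq0 tofrac_eq0 (negPf d0).
by move/eqP.
Qed.

Lemma frac_sub_bot v : frac_sub 0 v -> v = 0.
Proof.
move=> [d [x [d0 /cf_sub_bot -> /eqP]]].
by rewrite cell_mod_in0 scaler_eq0 tofrac_eq0 (negPf d0) => /eqP.
Qed.

Lemma frac_sub_top v : frac_sub (cf_len M) v.
Proof.
have [d d0 [x dx]] := cell_mod_denom v.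
by exists d, x; split=> //; apply: cf_sub_top.
Qed.

Lemma frac_quot_in j x : cf_sub M j.+1 x ->
  frac_quot (j := j) (cell_mod_in x) (cell_mod_in (cf_map (c := M) j x)).
Proof. by move=> Mx; exists 1, x; rewrite oner_neq0 tofrac1 !scale1r. Qed.

End FractionFiltration.

(** * Unitriangular families *)

Section Unitriangular.
Variables (F : fieldType) (V : lmodType F) (T : finType) (gt : rel T).
Hypotheses (gt_irr : irreflexive gt) (gt_trans : transitive gt).
Variables m f : T -> V.

(** Induction on the number of indices above t. *)
Lemma unitriangular_inv :
  (forall t, exists c : T -> F, m t = f t + \sum_(s | gt s t) c s *: f s) ->
  forall t, exists c : T -> F, f t = m t + \sum_(s | gt s t) c s *: m s.
Proof.
move=> mf t; have [n] := ubnP #|[pred s | gt s t]|; elim: n t => // n IH t lt_n.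
have /fin_all_exists [c' c'P] s : exists c' : T -> F,
    gt s t -> f s = m s + \sum_(u | gt u s) c' u *: m u.
  have [st|nst] := boolP (gt s t); last by exists (fun=> 0).
  have [|c' fs] := IH s; last by exists c'.
  rewrite ltnS in lt_n; apply: leq_trans lt_n; apply/proper_card/properP; split.
    by apply/subsetP=> u; rewrite !inE => us; apply: gt_trans st.
  by exists s; rewrite !inE // gt_irr.
have [c mt] := mf t.
exists (fun u => - (c u + \sum_(s | gt s t && gt u s) c s * c' s u)).
have fm : \sum_(s | gt s t) c s *: f s =
    \sum_(u | gt u t) (c u + \sum_(s | gt s t && gt u s) c s * c' s u) *: m u.
  transitivity (\sum_(s | gt s t) (c s *: m s + \sum_(u | gt u s) (c s * c' s u) *: m u)).
    apply: eq_bigr => s st; rewrite {1}(c'P s st) scalerDr scaler_sumr.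
    by congr (_ + _); apply: eq_bigr => u _; rewrite scalerA.
  rewrite big_split /= (exchange_big_dep (fun u => gt u t)) => [|s u st us] /=; last first.
    exact: gt_trans us st.
  rewrite -big_split; apply: eq_bigr => u _ /=.
  by rewrite scalerDl scaler_suml.
under eq_bigr => u _ do rewrite scaleNr.
by rewrite sumrN -fm mt addrK.
Qed.

End Unitriangular.

(** * Gelfand-Zeitlin idempotents and the Murphy basis *)

Section RingLemmas.
Variable E : nzRingType.

Lemma central_mul_mul (z z' a b : E) :
  central_idempotent z -> (a * z) * (b * z') = (a * b) * (z * z').
Proof. by move=> [_ cz]; rewrite -mulrA [z * _]mulrA cz -!mulrA. Qed.

End RingLemmas.

Section Sequence.
Variables (R : idomainType) (A : diagram_algebras R).
Variable z : forall r : nat, ca_shape (A r) -> alg_frac (A r).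
Hypothesis hz : forall (r : nat) (mu : ca_shape (A r)), is_cell_idempotent mu (z mu).
Local Notation F := {fraction R}.
Local Notation ein r := (@ext_in R (cell_based (A r))).

Lemma shape0_eq (mu nu : ca_shape (A 0)) : mu = nu.
Proof. by apply: (fintype_le1P _) => //; rewrite da_shape0. Qed.

Lemma path_FS r (nu : ca_shape (A r.+1)) (t : Std nu) :
  path_F z t = frac_map (da_incl A r) (path_F z (tagged t)) * z nu.
Proof. by []. Qed.

(** The top idempotents of the two paths are orthogonal, and central at that
    level. *)
Lemma path_F_orth_shape r (mu nu : ca_shape (A r)) (s : Std mu) (t : Std nu) :
  mu != nu -> path_F z s * path_F z t = 0.
Proof.
case: r mu nu s t => [mu nu _ _ /eqP[]|r mu nu s t munu]; first exact: shape0_eq.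
rewrite !path_FS; have [[cz _ _] _] := hz mu.
apply: etrans (central_mul_mul _ _ _ cz) _.
apply: etrans (congr1 ( *%R _) (cell_idempotent_orth (da_split A r.+1) (hz mu) (hz nu) munu)) _.
exact: mulr0.
Qed.

Lemma path_F_orth r (nu : ca_shape (A r)) (s t : Std nu) :
  path_F z s * path_F z t = if s == t then path_F z s else 0.
Proof.
elim: r nu s t => [nu [] []|r IH nu s t]; first exact: mulr1.
rewrite !path_FS; have [[cz _ _] _] := hz nu.
apply: etrans (central_mul_mul _ _ _ cz) _.
apply: etrans (congr1 ( *%R _) cz.1) _.
apply: etrans (congr1 ( *%R^~ _) (esym (frac_mapM _ _ _))) _.
case: s t => [la s] [la' t] /=; have [ee|ne] := eqVneq la la'.
  case: _ / ee t => t; rewrite IH.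
  have -> : (Tagged (fun la0 => Std (val la0)) s == Tagged (fun la0 => Std (val la0)) t) = (s == t).
    by rewrite -tag_eqE /tag_eq /= eqxx tagged_asE.
  by case: ifP => // _; rewrite frac_map0 mul0r.
rewrite path_F_orth_shape ?(inj_eq val_inj) // frac_map0.
case: eqP => [/(congr1 tag) /= e|_]; last exact: mul0r.
by case/eqP: ne.
Qed.

(** If the shapes at the top level are not comparable in the required sense, the
    cell ideal of tau, which contains m_tau, is annihilated by the last factor of
    F_s.  Otherwise the failure is at a lower level, and the relation
    m_tau d = u^* m_tau' moves everything but u into the image of that level. *)
Lemma murphy_element_path_F r (sigma tau : ca_shape (A r)) (s : Std sigma) (t : Std tau) :
  ~~ path_dom s t -> (ein r (da_m tau * path_d t) : alg_frac (A r)) * path_F z s = 0.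
Proof.
elim: r sigma tau s t => [sigma tau s t|r IH sigma tau s t].
  by case/negP; rewrite /= (shape0_eq tau sigma) lexx.
rewrite negb_and path_FS => /orP[nle|ndom].
  apply: etrans (mulrA _ _ _) _.
  apply: (cell_idempotent_ideal (da_split A r.+1) (hz sigma) nle).
  apply: frac_supported_mulr; first exact: upper_ge.
  apply/frac_supported_in/supported_mulr; first exact: upper_ge.
  by apply/supportedP; apply: da_m_ge.
have [u mu] := da_u (valP (tag t)).
have -> : da_m tau * path_d t =
    ca_inv _ u * da_incl A r (da_m (val (tag t)) * path_d (tagged t)).
  by rewrite rmorphM mulrA -mu -mulrA.
apply: etrans (mulrA _ _ _) _; apply: etrans (mul0r (z sigma)); congr (_ * _).
apply: etrans (congr1 ( *%R^~ _) (esym (ein_mul _ _))) _.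
apply: etrans (esym (mulrA _ _ _)) _.
apply: etrans _ (mulr0 (ein r.+1 (ca_inv _ u) : alg_frac (A r.+1))).
congr (_ * _); rewrite -frac_map_in; apply: etrans (esym (frac_mapM _ _ _)) _.
by rewrite (IH _ _ _ _ ndom) frac_map0.
Qed.

Lemma da_gen_neq0 r (la : ca_shape (A r)) : cell_mod_in (da_gen la) != 0.
Proof.
apply/eqP=> gen0; have [_ [x []]] := hz la.
have [d d0 [y dx]] := cell_mod_denom x; have [a ya] := da_cyclic y.
have : tofrac d *: x = 0 by rewrite dx ya cell_act_in gen0 cell_act0l.
move/eqP; rewrite scaler_eq0 tofrac_eq0 (negPf d0) => /eqP ->.
exact: cell_act0l.
Qed.

(** Modulo higher cells m_la is the tensor square of the generator, so in a row s
    where the generator has a nonzero coordinate, m_la y is that coordinate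
    times the action of y on the generator. *)
Lemma cell_act_gen_eq0 r (la : ca_shape (A r)) (y : alg_frac (A r)) :
  (ein r (da_m la) : alg_frac (A r)) * y = 0 ->
  cell_act_frac (cell_mod_in (da_gen la)) y = 0.
Proof.
move=> my; have [s|gen0] := pickP (fun s => cell_mod_in (da_gen la) s != 0); last first.
  by case/eqP: (da_gen_neq0 la); apply/ffunP=> s; rewrite [RHS]ffunE; apply/eqP/negbFE/gen0.
rewrite ffunE => gs; apply/ffunP=> v; rewrite [RHS]ffunE.
have /supportedP sg := da_m_gen la.
set g := cell_tensor _ _ in sg.
have gE : (ein r g : alg_frac (A r)) =
    \sum_s' tofrac (da_gen la s' : R) *: cell_row s' (cell_mod_in (da_gen la)).
  rewrite (@ext_in_sum R (cell_based (A r))); apply: eq_bigr => s' _.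
  rewrite (@ext_in_sum R (cell_based (A r))) scaler_sumr; apply: eq_bigr => t _.
  by rewrite (@ext_inZ R (cell_based (A r))) tofracM ffunE scalerA.
have key : ((ein r g : alg_frac (A r)) * y) (cell_index s v) = 0.
  have mE : (ein r (da_m la) : alg_frac (A r)) = ein r (da_m la - g) + ein r g.
    by rewrite -(@ext_inD R (cell_based (A r))) subrK.
  have /(congr1 (fun x : alg_frac (A r) => x (cell_index s v))) := my.
  rewrite [X in _ = X -> _]ffunE => <-; rewrite mE; apply: esym.
  apply: etrans (congr1 (fun x : alg_frac (A r) => x (cell_index s v)) (mulrDl _ _ _)) _.
  apply: etrans (frac_addE _ _ _) _; apply: etrans _ (add0r _); congr (_ + _).
  apply: (frac_supported_mulr (@upper_gt R _ la)); first exact: frac_supported_in.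
  by rewrite /= ltxx.
move: key; rewrite gE mulr_suml sum_ffunE (bigD1 s) //= big1 => [|s' s's].
  rewrite addr0 => /eqP key; apply/eqP; move: key.
  have -> : ((tofrac (da_gen la s : R) *: cell_row s (cell_mod_in (da_gen la))) * y)
      (cell_index s v) = tofrac (da_gen la s : R) * cell_act_frac (cell_mod_in (da_gen la)) y v.
    apply: etrans (congr1 (fun x : alg_frac (A r) => x (cell_index s v)) (esym (scalerAl _ _ _))) _.
    by apply: etrans (ffunE _ _) _; congr (_ * _); apply: esym (cell_act_row _ _ _ _).
  by rewrite mulf_eq0 (negPf gs).
apply: etrans (congr1 (fun x : alg_frac (A r) => x (cell_index s v)) (esym (scalerAl _ _ _))) _.
apply: etrans (ffunE _ _) _.
by rewrite cell_row_mul_coord (negPf s's) mul0r scaler0.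
Qed.

Lemma murphy_path_F r (la : ca_shape (A r)) (s t : Std la) :
  ~~ path_dom s t -> cell_act_frac (cell_mod_in (murphy t)) (path_F z s) = 0.
Proof.
move=> ndom; rewrite /murphy cell_act_in; apply: etrans (esym (cell_actM _ _ _)) _.
apply: cell_act_gen_eq0; apply: etrans (mulrA _ _ _) _.
apply: etrans (congr1 ( *%R^~ _) (ein_mul _ _)) _.
exact: murphy_element_path_F.
Qed.

Lemma is_branch_shape r (nu : ca_shape (A r.+1)) (j : 'I_(cf_len (da_filt nu))) :
  is_branch (da_filt nu) (cf_shape j).
Proof. by apply/existsP; exists j. Qed.

Definition path_extend r (nu : ca_shape (A r.+1)) (j : 'I_(cf_len (da_filt nu)))
    (t : Std (cf_shape j)) : Std nu :=
  @existT {la : ca_shape (A r) | is_branch (da_filt nu) la} (fun la => Std (val la))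
    (exist _ (cf_shape j) (is_branch_shape j)) t.

Lemma path_extend_surj r (nu : ca_shape (A r.+1)) (t : Std nu) :
  exists j (t' : Std (cf_shape (c := da_filt nu) j)), t = path_extend t'.
Proof.
case: t => [[la br] t]; have /existsP [j /eqP jla] := br.
case: _ / jla br t => br t; exists j, t.
by rewrite /path_extend (bool_irrelevance br (is_branch_shape j)).
Qed.

(** The last factor of the idempotent of the extended path acts as the identity,
    so both vectors arise by applying the same element of the smaller algebra to
    Murphy vectors, which correspond by the choice of the branching factors. *)
Lemma seminormal_quot r (nu : ca_shape (A r.+1)) (j : 'I_(cf_len (da_filt nu)))
    (t : Std (cf_shape j)) :
  frac_quot (j := j) (seminormal z (path_extend t)) (seminormal z t).
Proof.
have mE : murphy (path_extend t) =
    cell_act (cell_act (da_gen nu) (da_d (cf_shape j) nu)) (da_incl A r (path_d t)).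
  exact: cell_act_mul.
have sub := da_d_sub j.
have -> : seminormal z (path_extend t) =
    cell_act_frac (cell_mod_in (murphy (path_extend t))) (frac_map (da_incl A r) (path_F z t)).
  rewrite /seminormal path_FS; apply: etrans (cell_actM _ _ _) _.
  exact: (cell_idempotent_act (da_split A r.+1)).
apply: frac_quot_act.
have -> : murphy t = cf_map j (murphy (path_extend t)).
  by rewrite mE cf_map_act // da_d_map.
by apply: frac_quot_in; rewrite mE; apply: cf_sub_act.
Qed.

Lemma seminormal_neq0 r (la : ca_shape (A r)) (t : Std la) : seminormal z t != 0.
Proof.
elim: r la t => [la t|r IH la t].
  rewrite /seminormal /murphy /= cell_act_in.
  apply: contra (da_gen_neq0 la) => /eqP e; apply/eqP.
  by rewrite -[LHS]cell_act1 -[X in cell_act_frac X _]cell_act1.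
have [j [t' ->]] := path_extend_surj t; apply: contraNneq (IH _ t') => t0.
by have := seminormal_quot t'; rewrite t0 => /frac_quot0 ->.
Qed.

Lemma seminormal_path_F r (la : ca_shape (A r)) (s t : Std la) :
  cell_act_frac (seminormal z t) (path_F z s) = if t == s then seminormal z t else 0.
Proof.
rewrite /seminormal -cell_actM; apply: etrans (congr1 (cell_act_frac _) (path_F_orth t s)) _.
by case: ifP => // _; apply: cell_act0r.
Qed.

(** Climbing the filtration: modulo the previous term, a vector agrees with the
    combination of seminormal vectors that expands its image in the section. *)
Lemma seminormal_span r (la : ca_shape (A r)) (v : cell_mod_frac la) :
  exists c : Std la -> F, v = \sum_t c t *: seminormal z t.
Proof.
elim: r la v => [la v|r IH nu v].
  have [d d0 [x dv]] := cell_mod_denom v; have [a xa] := da_cyclic x.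
  have [k' _ kK] := da_alg0 A; rewrite -(kK a) in xa.
  exists (fun=> tofrac (k' a) / tofrac d); rewrite (big_pred1 tt) => [|[]//].
  rewrite /seminormal /murphy /= !cell_act_in.
  rewrite -[cell_act_frac (cell_act_frac _ _) _]cell_actM.
  have -> : (ein 0 1 : alg_frac (A 0)) * 1 = 1 by apply: mulr1.
  rewrite cell_act1 mulrC -scalerA -cell_mod_inZ -cell_act_scalar -xa -dv.
  by rewrite scalerA mulVf ?scale1r // tofrac_eq0.
suff main k : (k <= cf_len (da_filt nu))%N -> forall v, frac_sub (da_filt nu) k v ->
    exists c : Std nu -> F, v = \sum_t c t *: seminormal z t.
  by apply: (main _ (leqnn _)); apply: frac_sub_top.
elim: k => [_ w /frac_sub_bot -> | k IHk ltk w Mw].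
  by exists (fun=> 0); rewrite big1 // => t _; rewrite scale0r.
pose j := Ordinal ltk; have [w' ww'] := @frac_quot_total _ _ _ _ _ (da_filt nu) j w Mw.
have [c w'E] := IH _ w'.
have quot_sum : frac_quot (j := j) (\sum_t c t *: seminormal z (path_extend t)) w'.
  rewrite w'E; elim/big_rec2: _ => [|t a b _ ab].
    exact: frac_quot00.
  by apply: frac_quotD => //; apply: frac_quotZ; apply: seminormal_quot.
have := frac_quotD ww' (frac_quotZ (-1) quot_sum).
rewrite !scaleN1r subrr => /frac_quot_ker /(IHk (ltnW ltk)) [c' wE].
exists (fun t => c' t + \sum_(t' | path_extend t' == t) c t').
have -> : w = \sum_t c' t *: seminormal z t + \sum_t c t *: seminormal z (path_extend t).
  by rewrite -wE subrK.
under [RHS]eq_bigr => t _ do rewrite scalerDl.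
rewrite big_split /=; congr (_ + _).
rewrite (partition_big (@path_extend _ nu j) predT) //=; apply: eq_bigr => t _.
by rewrite scaler_suml; apply: eq_bigr => t' /eqP ->.
Qed.

End Sequence.

(** * The dominance order on paths *)

Section Dominance.
Variables (R : idomainType) (A : diagram_algebras R).

Lemma path_dom_shape r (mu nu : ca_shape (A r)) (s : Std mu) (t : Std nu) :
  path_dom s t -> (nu <= mu)%O.
Proof. by case: r mu nu s t => [//|r] mu nu s t /andP[]. Qed.

Lemma path_dom_trans r (ka mu nu : ca_shape (A r)) (s : Std ka) (t : Std mu) (u : Std nu) :
  path_dom s t -> path_dom t u -> path_dom s u.
Proof.
elim: r ka mu nu s t u => [|r IH] ka mu nu s t u.
  by move=> kamu munu; apply: le_trans munu kamu.
move=> /andP[kamu st] /andP[munu tu]; apply/andP; split.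
  exact: le_trans munu kamu.
exact: IH st tu.
Qed.

Lemma path_dom_anti r (nu : ca_shape (A r)) (s t : Std nu) :
  path_dom s t -> path_dom t s -> s = t.
Proof.
elim: r nu s t => [nu [] [] //|r IH nu [la s] [la' t]] /andP[_ /= st] /andP[_ /= ts].
have e : la = la'.
  apply/val_inj/le_anti.
  by rewrite (path_dom_shape st) (path_dom_shape ts).
by case: _ / e t st ts => t st ts; rewrite (IH _ s t).
Qed.

Lemma path_sdom_irr r (nu : ca_shape (A r)) : irreflexive (@path_sdom R A r nu).
Proof. by move=> s; rewrite /path_sdom eqxx andbF. Qed.

Lemma path_sdom_trans r (nu : ca_shape (A r)) : transitive (@path_sdom R A r nu).
Proof.
move=> t s u /andP[st nst] /andP[tu ntu]; rewrite /path_sdom (path_dom_trans st tu).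
by apply: contraNneq nst => su; apply/eqP/(path_dom_anti st); rewrite su.
Qed.

End Dominance.

Theorem theorem3p5 (R : idomainType) (A : diagram_algebras R)
    (z : forall r : nat, ca_shape (A r) -> alg_frac (A r))
    (hz : forall (r : nat) (mu : ca_shape (A r)), is_cell_idempotent mu (z r mu))
    (r : nat) (la : ca_shape (A r)) :
  (forall t : Std la, exists rc rc' : Std la -> {fraction R},
      cell_mod_in (murphy t) =
        seminormal z t + \sum_(s : Std la | path_sdom s t) rc s *: seminormal z s
   /\ seminormal z t =
        cell_mod_in (murphy t)
        + \sum_(s : Std la | path_sdom s t) rc' s *: cell_mod_in (murphy s))
  /\ basis_of (fullv : {vspace cell_mod_frac la})
       [seq seminormal z t | t : Std la].
Proof.
have coordF (c : Std la -> {fraction R}) s :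
    cell_act_frac (\sum_t c t *: seminormal z t) (path_F z s) = c s *: seminormal z s.
  rewrite cell_act_suml (bigD1 s) //= big1 ?addr0 => [|t ts].
    by rewrite cell_actZl seminormal_path_F // eqxx.
  by rewrite cell_actZl seminormal_path_F // (negPf ts) scaler0.
(* The coefficients come from the spanning family; F_s isolates the one of f_s
   and shows that it vanishes unless s dominates t. *)
have mf t : exists c : Std la -> {fraction R}, cell_mod_in (murphy t) =
    seminormal z t + \sum_(s | path_sdom s t) c s *: seminormal z s.
  have [c mE] := seminormal_span hz (cell_mod_in (murphy t)).
  have cE s : c s *: seminormal z s = cell_act_frac (cell_mod_in (murphy t)) (path_F z s).
    by rewrite mE coordF.
  exists c; rewrite {1}mE (bigD1 t) //= cE; congr (_ + _).
  rewrite [RHS]big_mkcond [LHS]big_mkcond /=; apply: eq_bigr => s _.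
  rewrite /path_sdom; have [ts|] := boolP (path_dom s t); first by [].
  by move=> nst; case: ifP => //= _; rewrite cE murphy_path_F.
split=> [t|].
  have [c mE] := mf t.
  have [c' fE] := unitriangular_inv (@path_sdom_irr R A r la) (@path_sdom_trans R A r la) mf t.
  by exists c, c'.
rewrite /basis_of; apply/andP; split.
  rewrite eqEsubv subvf; apply/subvP=> v _; have [c ->] := seminormal_span hz v.
  apply: memv_suml => t _; apply/memvZ/memv_span/mapP.
  by exists t; rewrite ?mem_enum.
pose f := image_tuple (fun t : Std la => seminormal z t) predT.
suff: free f by [].
apply/freeP => k k0 i.
have f_i (j : 'I_#|@predT (Std la)|) : f`_j = seminormal z (enum_val j).
  exact: nth_image.
have := congr1 (fun v => cell_act_frac v (path_F z (enum_val i))) k0.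
rewrite cell_act0l cell_act_suml (bigD1 i) //= big1 => [|j ji].
  rewrite addr0 cell_actZl f_i seminormal_path_F // eqxx => /eqP.
  by rewrite scaler_eq0 (negPf (seminormal_neq0 hz _)) orbF => /eqP.
by rewrite cell_actZl f_i seminormal_path_F // (inj_eq enum_val_inj) (negPf ji) scaler0.
Qed.
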